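(* Let $K\subset\mathbb{R}^n$ be open and let $\mathcal W=(\mathcal W_1,\dots,\mathcal W_s)$ be a finite tuple of operators of class $\mathcal O_K$. If $\mathcal W$ is regularly dependent at a point $(\bar x,\bar p)\in K\times\mathbb{R}^n$, then there exists a neighborhood $O\subset K\times\mathbb{R}^n$ of $(\bar x,\bar p)$ such that $\mathcal W$ is not quasi-independent at any point of $O$. In particular, $\mathcal W$ is not globally quasi-independent.
   Context: Operators. Let $\hat p_i:=\partial/\partial x_i$. An operator of class $\mathcal O_K$ is a real linear differential operator $\mathcal F=\sum_{|\alpha|\le m}A_\alpha(x)\hat p^\alpha$ with real $A_\alpha\in C^\infty(K)$, $\hat p^\alpha=\partial^{|\alpha|}/\partial x_1^{\alpha_1}\cdots\partial x_n^{\alpha_n}$; two operators are equal if they agree on every $\psi\in C^\infty(K)$ (the coefficients $A_\alpha$ are then uniquely determined). Its symbol is $F(x,p)=\sum_\alpha A_\alpha(x)p^\alpha$ on $K\times\mathbb{R}^n$. For $g\ge 0$, $H_g(\mathcal F):=\sum_{|\alpha|=g}A_\alpha\hat p^\alpha$ and $H_g(F)$ is its symbol. If $\mathcal F\neq0$, its order $\mathrm{ord}\,\mathcal F$ is the largest $m$ with $H_m(\mathcal F)\ne0$ and $MF:=H_m(F)$ is the main part of the symbol; if $\mathcal F=0$, $MF:=0$. Operators of order $0$ are multiplication by smooth functions. For a tuple $\mathcal W$, $MW:=(MW_1,\dots,MW_s):K\times\mathbb{R}^n\to\mathbb{R}^s$. $\mathcal W$ is quasi-independent at $(x,p)$ if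 $d(MW_1),\dots,d(MW_s)$ are linearly independent at $(x,p)$; globally quasi-independent if this holds at almost every point of $K\times\mathbb{R}^n$. Noncommutative polynomials. With commuting variables $G=(G_1,\dots,G_l)$ and noncommuting variables $F=(F_1,\dots,F_r)$, a monomial associated with a finite sequence $\beta=(\beta_1,\dots,\beta_q)$, $\beta_i\in\{1,\dots,r\}$, $q\ge0$, is a formal product $Z_0(G)F_{\beta_1}Z_1(G)\cdots F_{\beta_q}Z_q(G)$ with $Z_j\in C^\infty(\mathbb{R}^l)$, multilinear over $\mathbb R$ in the $Z_j$; a noncommutative polynomial $S=\sum_\beta S_\beta$ is a finite formal sum of monomials ($S_\beta$ collecting those associated with $\beta$), and $S=0$ iff every $S_\beta=0$. Its abelianization $S_C:\mathbb{R}^{l+r}\to\mathbb{R}$ is obtained by letting all variables commute (the monomial above gives $Z_0(G)\cdots Z_q(G)F_{\beta_1}\cdots F_{\beta_q}$). For weights $w=(w_1,\dots,w_r)$, $C_{d,w}(S):=\sum_{\beta:\sum_j w_{\beta_j}=d}S_\beta$; for $S\ne0$, $\deg_wS$ is the largest $d$ with $C_{d,w}(S)\ne0$ and $\mathcal M_wS:=C_{\deg_wS,w}(S)$ ($\mathcal M_w0:=0$). When a polynomial is evaluated on a tuple of class $\mathcal O_K$ operators, the operators of order $0$ are substituted for commuting variables (each $Z_j(G)$ becoming multiplication by $Z_j$ of those functions) and the others for noncommuting variables; $\mathcal M_{(\cdot)}S$ denotes the main part with weights $w_i=$ order of the operator substituted for $F_i$. Dependence. For tuples $\mathcal W=(\mathcal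 W_1,\dots,\mathcal W_s)$, $\mathcal Y=(\mathcal Y_1,\dots,\mathcal Y_r)$ and $(\bar W,\bar Y)=(MW,MY)(\bar x,\bar p)$: $\mathcal W$ is algebraically dependent on $\mathcal Y$ at $(\bar x,\bar p)$ if there are noncommutative polynomials $S_1,\dots,S_s$ in variables $(W,Y)$ corresponding to $(\mathcal W,\mathcal Y)$ with (1) $\det\big(\partial(\mathcal M_{(\mathcal W,\mathcal Y)}S_i)_C/\partial W_j\big)_{i,j=1}^s(\bar W,\bar Y)\ne0$ and (2) a neighborhood $H\subset K$ of $\bar x$ with $S_i(\mathcal W,\mathcal Y)\psi=0$ on $H$ for all $\psi\in C^\infty(H)$ and all $i$. $\mathcal W\sqsubseteq\mathcal Y$ at $(\bar x,\bar p)$ (algebraic containment) if there are tuples $\mathcal Z^{(1)},\dots,\mathcal Z^{(q)}$ ($q\ge 0$) with $\mathcal W$ algebraically dependent on $\mathcal Z^{(1)}$, $\mathcal Z^{(i)}$ on $\mathcal Z^{(i+1)}$, and $\mathcal Z^{(q)}$ on $\mathcal Y$ (for $q=0$: $\mathcal W$ on $\mathcal Y$), all at $(\bar x,\bar p)$. $\mathcal W$ (with $s$ operators) is regularly dependent at $(\bar x,\bar p)$ if $\mathcal W\sqsubseteq\mathcal Y$ at that point for some tuple $\mathcal Y$ of $r<s$ operators of class $\mathcal O_K$. *)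

(* Defs.v *)
From HB Require Import structures.
From mathcomp Require Import all_boot all_order all_algebra.
From mathcomp Require Import all_classical all_reals all_analysis.
Set Implicit Arguments. Unset Strict Implicit. Unset Printing Implicit Defensive.
Import Order.TTheory GRing.Theory Num.Theory.
Import numFieldNormedType.Exports.
Local Open Scope classical_set_scope.
Local Open Scope ring_scope.

Section Defs.
Variable R : realType.

Definition unitv (m : nat) (i : 'I_m) : 'rV[R]_m := delta_mx 0 i.

Definition partial (m : nat) (i : 'I_m) (f : 'rV[R]_m -> R) : 'rV[R]_m -> R :=
  fun x => 'D_(unitv i) f x.

Definition iterd (m : nat) (l : seq 'I_m) (f : 'rV[R]_m -> R) : 'rV[R]_m -> R :=
  foldr (fun i g => partial i g) f l.

Definition smooth_on (m : nat) (U : set 'rV[R]_m) (f : 'rV[R]_m -> R) : Prop :=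
  forall (l : seq 'I_m) (x : 'rV[R]_m), U x ->
    {for x, continuous (iterd l f)} /\
    forall i : 'I_m, derivable (iterd l f) x (unitv i).

(* F = sum_{alpha} A_alpha(x) p^alpha, multi-indices alpha with entries <= op_bnd *)
Record Op (n : nat) := MkOp {
  op_bnd : nat ;
  op_coef : {ffun 'I_n -> 'I_op_bnd.+1} -> 'rV[R]_n -> R }.

Definition mabs (n b : nat) (alpha : {ffun 'I_n -> 'I_b}) : nat :=
  (\sum_(i < n) (alpha i : nat))%N.

Definition dmulti (n b : nat) (alpha : {ffun 'I_n -> 'I_b}) (f : 'rV[R]_n -> R) :=
  foldr (fun i g => iter (alpha i : nat) (partial i) g) f (enum 'I_n).

Definition op_apply (n : nat) (F : Op n) (psi : 'rV[R]_n -> R) : 'rV[R]_n -> R :=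
  fun x => \sum_(alpha : {ffun 'I_n -> 'I_(op_bnd F).+1})
             @op_coef n F alpha x * dmulti alpha psi x.

Definition classO (n : nat) (K : set 'rV[R]_n) (F : Op n) : Prop :=
  forall alpha, smooth_on K (@op_coef n F alpha).

Definition Hg (n : nat) (F : Op n) (g : nat) : Op n :=
  @MkOp n (op_bnd F) (fun alpha => if mabs alpha == g then @op_coef n F alpha else 0).

Definition op_nz (n : nat) (K : set 'rV[R]_n) (F : Op n) : Prop :=
  exists psi, smooth_on K psi /\ exists x, K x /\ op_apply F psi x <> 0.

Definition ord (n : nat) (K : set 'rV[R]_n) (F : Op n) : nat :=
  (\max_(g < (op_bnd F * n).+1 | `[< op_nz K (Hg F g) >]) (g : nat))%N.

Definition symbol (n : nat) (F : Op n) (x p : 'rV[R]_n) : R :=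
  \sum_(alpha : {ffun 'I_n -> 'I_(op_bnd F).+1})
     @op_coef n F alpha x * \prod_(i < n) (p 0 i) ^+ (alpha i : nat).

Definition msym (n : nat) (K : set 'rV[R]_n) (F : Op n) (x p : 'rV[R]_n) : R :=
  if `[< op_nz K F >] then symbol (Hg F (ord K F)) x p else 0.

Definition jac (n s : nat) (K : set 'rV[R]_n) (W : 'I_s -> Op n) (x p : 'rV[R]_n)
  : 'M[R]_(s, n + n) :=
  \matrix_(i < s, j < n + n)
    match fintype.split j with
    | inl a => 'D_(unitv a) (fun y => msym K (W i) y p) x
    | inr b => 'D_(unitv b) (fun q => msym K (W i) x q) p
    end.

Definition quasi_indep (n s : nat) (K : set 'rV[R]_n) (W : 'I_s -> Op n)
  (x p : 'rV[R]_n) : Prop := row_free (jac K W x p).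

Definition in_box (m : nat) (a b z : 'rV[R]_m) : Prop :=
  forall i, a 0 i <= z 0 i <= b 0 i.
Definition box_vol (m : nat) (a b : 'rV[R]_m) : R := \prod_(i < m) (b 0 i - a 0 i).
Definition null_set (m : nat) (A : set 'rV[R]_m) : Prop :=
  forall eps : R, 0 < eps -> exists a b : nat -> 'rV[R]_m,
    (forall k i, a k 0 i <= b k 0 i) /\
    (forall z, A z -> exists k, in_box (a k) (b k) z) /\
    (forall N, \sum_(k < N) box_vol (a k) (b k) <= eps).

Definition globally_quasi_indep (n s : nat) (K : set 'rV[R]_n) (W : 'I_s -> Op n)
  : Prop :=
  null_set [set z : 'rV[R]_(n + n) |
              K (lsubmx z) /\ ~ quasi_indep K W (lsubmx z) (rsubmx z)].

(* Variables are indexed by 'I_N, the positions in a tuple T of operators.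
   Coefficient functions Z_j in C^infty(R^l) (l = number of commuting
   variables) are represented as smooth functions on R^N that depend only
   on the commuting coordinates.  A monomial
     Z_0(G) F_{b_1} Z_1(G) ... F_{b_q} Z_q(G)
   is stored as Z_0 together with the list [(b_1,Z_1); ...; (b_q,Z_q)].  *)

Record Mono (N : nat) := MkMono {
  m_Z0 : 'rV[R]_N -> R ;
  m_rest : seq ('I_N * ('rV[R]_N -> R)) }.

Definition Poly (N : nat) := seq (Mono N).

Section PolyT.
Variables (n N : nat) (K : set 'rV[R]_n) (T : 'I_N -> Op n).

Definition commuting (k : 'I_N) : bool := (ord K (T k) == 0)%N.

Definition wf_fun (Z : 'rV[R]_N -> R) : Prop :=
  smooth_on [set: 'rV[R]_N] Z /\
  forall v v' : 'rV[R]_N, (forall k, commuting k -> v 0 k = v' 0 k) -> Z v = Z v'.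

Definition wf_mono (m : Mono N) : Prop :=
  wf_fun (m_Z0 m) /\
  foldr (fun bz P => (~~ commuting bz.1 /\ wf_fun bz.2) /\ P) True (m_rest m).

Definition wf_poly (S : Poly N) : Prop := foldr (fun m P => wf_mono m /\ P) True S.

Definition beta (m : Mono N) : seq 'I_N := map fst (m_rest m).

Definition weight (m : Mono N) : nat :=
  (\sum_(bz <- m_rest m) ord K (T bz.1))%N.

Fixpoint prodZ (rest : seq ('I_N * ('rV[R]_N -> R))) (y : nat -> 'rV[R]_N) (k : nat)
  : R :=
  match rest with
  | [::] => 1
  | bz :: rs => bz.2 (y k) * prodZ rs y k.+1
  end.

(* S_beta = 0 in the tensor product C^infty(R^l)^{(q+1)}, tested through the
   (injective) realization of the algebraic tensor product as functions of
   q+1 independent arguments *)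
Definition Sbeta_zero (S : Poly N) (b : seq 'I_N) : Prop :=
  forall y : nat -> 'rV[R]_N,
    \sum_(m <- S | beta m == b) m_Z0 m (y 0%N) * prodZ (m_rest m) y 1 = 0.

Definition poly_zero (S : Poly N) : Prop := forall b, Sbeta_zero S b.

Definition Cd (d : nat) (S : Poly N) : Poly N := [seq m <- S | weight m == d].

Definition degw (S : Poly N) : nat :=
  (\max_(m <- S | `[< ~ poly_zero (Cd (weight m) S) >]) weight m)%N.

Definition mainpart (S : Poly N) : Poly N :=
  if `[< poly_zero S >] then [::] else Cd (degw S) S.

Definition abel (S : Poly N) (v : 'rV[R]_N) : R :=
  \sum_(m <- S) m_Z0 m v * \prod_(bz <- m_rest m) (bz.2 v * v 0 bz.1).

Definition gvec (x : 'rV[R]_n) : 'rV[R]_N :=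
  \row_k (if commuting k then @op_coef n (T k) [ffun => ord0] x else 0).

Fixpoint act_rest (rest : seq ('I_N * ('rV[R]_N -> R))) (psi : 'rV[R]_n -> R)
  : 'rV[R]_n -> R :=
  match rest with
  | [::] => psi
  | bz :: rs => op_apply (T bz.1) (fun x => bz.2 (gvec x) * act_rest rs psi x)
  end.

Definition poly_act (S : Poly N) (psi : 'rV[R]_n -> R) : 'rV[R]_n -> R :=
  fun x => \sum_(m <- S) m_Z0 m (gvec x) * act_rest (m_rest m) psi x.

End PolyT.

Definition catT (n s r : nat) (W : 'I_s -> Op n) (Y : 'I_r -> Op n)
  : 'I_(s + r) -> Op n :=
  fun k => match fintype.split k with inl i => W i | inr j => Y j end.

Definition classO_tuple (n s : nat) (K : set 'rV[R]_n) (W : 'I_s -> Op n) : Prop :=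
  forall i, classO K (W i).

Definition alg_dep (n : nat) (K : set 'rV[R]_n) (s r : nat)
  (W : 'I_s -> Op n) (Y : 'I_r -> Op n) (xb pb : 'rV[R]_n) : Prop :=
  let T := catT W Y in
  exists S : 'I_s -> Poly (s + r),
    (forall i, wf_poly K T (S i)) /\
    \det (\matrix_(i < s, j < s)
            'D_(unitv (lshift r j)) (abel (mainpart K T (S i)))
              (\row_k msym K (T k) xb pb)) != 0 /\
    exists H : set 'rV[R]_n, open H /\ H xb /\ H `<=` K /\
      forall i psi, smooth_on H psi -> forall x, H x -> poly_act K T (S i) psi x = 0.

Inductive alg_contained (n : nat) (K : set 'rV[R]_n) (xb pb : 'rV[R]_n)
  : forall s : nat, ('I_s -> Op n) -> forall r : nat, ('I_r -> Op n) -> Prop :=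
| ac_dep (s : nat) (W : 'I_s -> Op n) (r : nat) (Y : 'I_r -> Op n) :
    alg_dep K W Y xb pb -> @alg_contained n K xb pb s W r Y
| ac_step (s : nat) (W : 'I_s -> Op n) (k : nat) (Z : 'I_k -> Op n)
    (r : nat) (Y : 'I_r -> Op n) :
    classO_tuple K Z -> alg_dep K W Z xb pb ->
    @alg_contained n K xb pb k Z r Y -> @alg_contained n K xb pb s W r Y.

Definition regularly_dependent (n s : nat) (K : set 'rV[R]_n) (W : 'I_s -> Op n)
  (xb pb : 'rV[R]_n) : Prop :=
  exists (r : nat) (Y : 'I_r -> Op n),
    (r < s)%N /\ classO_tuple K Y /\ alg_contained K xb pb W Y.

End Defs.

(* Main.v *)
(* Fix x in H and p, and put phi(y) = p.(y - x).  Applying S_i(W, Z) = 0 to the test function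
   phi^d / d!, where d is the weighted degree of S_i, and evaluating at x kills all monomials
   of weight < d and turns those of weight d into products of main symbols; this gives the
   identity (M S_i)_C (MW, MZ) = 0 on H x R^n.  Monomials of weight > d cancel because the
   formal vanishing of S_beta forces the vanishing of its action.  Differentiating the
   identity, and inverting the matrix of the derivatives with respect to W near the base
   point, puts the rows of the Jacobian of MW in the row space of the Jacobian of MZ.  Along
   the chain defining algebraic containment the rank is therefore at most r < s.  Finally,
   a neighborhood contains a box, and a box is not a null set. *)

Require Import Defs.
From HB Require Import structures.
From mathcomp Require Import all_boot all_order all_algebra.
From mathcomp Require Import all_classical all_reals all_analysis.
From mathcomp Require Import measurable_realfun ring lra.
Import Order.TTheory GRing.Theory Num.Theory.
Import numFieldNormedType.Exports.
Local Open Scope classical_set_scope.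
Local Open Scope ring_scope.

Set Implicit Arguments. Unset Strict Implicit. Unset Printing Implicit Defensive.

(** * Partial derivatives and smooth functions *)

Section Differentiability.
Variable R : realType.

Lemma ler_coord_norm m (h : 'rV[R]_m) i : `|h 0 i| <= `|h|.
Proof.
rewrite [leRHS]/Num.Def.normr/= mx_normrE.
exact: (le_bigmax _ (fun ij => `|h ij.1 ij.2|) (0, i)).
Qed.

Lemma rV_norm_le m (h : 'rV[R]_m) (d : R) :
  0 <= d -> (forall i, `|h 0 i| <= d) -> `|h| <= d.
Proof.
move=> d0 hd; rewrite [leLHS]/Num.Def.normr/= mx_normrE.
by apply: bigmax_le => // -[i j] _ /=; rewrite ord1.
Qed.

Lemma is_derive_line (V : normedModType R) (f : V -> R) (z v : V) (t : R) :
  derivable f (z + t *: v) v ->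
  is_derive t (1 : R) (fun t => f (z + t *: v)) ('D_v f (z + t *: v)).
Proof.
have E : (fun h : R => h^-1 *: (((fun t => f (z + t *: v)) \o shift t) (h *: (1 : R))
    - f (z + t *: v))) =
  (fun h : R => h^-1 *: ((f \o shift (z + t *: v)) (h *: v) - f (z + t *: v))).
  apply/funext => h /=; congr (_ *: (f _ - _)).
  by rewrite [h *: 1]mulr1 scalerDl addrCA.
by move=> df; split; rewrite /derivable /derive /= E.
Qed.

(** The increment [a] may have either sign, so the mean value theorem is applied on [[0, a]] or on
    [[a, 0]], and [c] is located only by its absolute value. *)
Lemma MVT_line (V : normedModType R) (f : V -> R) (z v : V) (a : R) :
  (forall t, `|t| <= `|a| -> derivable f (z + t *: v) v) ->
  exists2 c, `|c| <= `|a| & f (z + a *: v) - f z = 'D_v f (z + c *: v) * a.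
Proof.
move=> df; pose g t := f (z + t *: v).
have dg t : `|t| <= `|a| -> is_derive t (1 : R) g ('D_v f (z + t *: v)).
  by move=> /df; exact: is_derive_line.
have cg t : `|t| <= `|a| -> {for t, continuous g}.
  move=> /dg [dgt _]; exact/differentiable_continuous/derivable1_diffP.
have g0 : g 0 = f z by rewrite /g scale0r addr0.
have [a0|a0] := leP 0 a.
  have [||c] := @MVT_segment R g (fun t => 'D_v f (z + t *: v)) 0 a a0.
  - move=> t; rewrite in_itv/= => /andP[t0 ta]; apply: dg.
    rewrite !ger0_norm ?(ltW ta) ?(ltW t0) //.
  - apply: continuous_in_subspaceT => t; rewrite inE/= in_itv/= => /andP[t0 ta].
    by apply: cg; rewrite !ger0_norm.
  rewrite in_itv/= => /andP[c0 ca] E; exists c; first by rewrite !ger0_norm.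
  by rewrite -g0 -/(g a) E subr0.
have [||c] := @MVT_segment R g (fun t => 'D_v f (z + t *: v)) a 0 (ltW a0).
- move=> t; rewrite in_itv/= => /andP[t0 ta]; apply: dg.
  by rewrite !ler0_norm ?lerN2 ?ltW.
- apply: continuous_in_subspaceT => t; rewrite inE/= in_itv/= => /andP[t0 ta].
  by apply: cg; rewrite !ler0_norm ?lerN2// ltW.
rewrite in_itv/= => /andP[c0 ca] E; exists c.
  by rewrite !ler0_norm ?lerN2// ltW.
by rewrite -g0 -/(g a) -opprB E sub0r mulrN opprK.
Qed.

Lemma continuous_sum (T : topologicalType) (I : Type) (r : seq I) (P : pred I)
    (F : I -> T -> R) (x : T) :
  (forall i, P i -> {for x, continuous (F i)}) ->
  {for x, continuous (fun y => \sum_(i <- r | P i) F i y)}.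
Proof.
move=> cF; rewrite /prop_for /continuous_at; elim: r => [|i r IHr].
  rewrite big_nil; under eq_fun do rewrite big_nil; exact: cvg_cst.
rewrite big_cons; under eq_fun do rewrite big_cons.
case: ifP => // Pi; apply: cvgD => //; exact: cF.
Qed.

Lemma continuous_prod (T : topologicalType) (I : Type) (r : seq I) (P : pred I)
    (F : I -> T -> R) (x : T) :
  (forall i, P i -> {for x, continuous (F i)}) ->
  {for x, continuous (fun y => \prod_(i <- r | P i) F i y)}.
Proof.
move=> cF; rewrite /prop_for /continuous_at; elim: r => [|i r IHr].
  rewrite big_nil; under eq_fun do rewrite big_nil; exact: cvg_cst.
rewrite big_cons; under eq_fun do rewrite big_cons.
case: ifP => // Pi; apply: cvgM => //; exact: cF.
Qed.

Lemma rV_continuous (T : topologicalType) m (g : T -> 'rV[R]_m) (x : T) :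
  (forall j, {for x, continuous (fun y => g y 0 j)}) -> {for x, continuous g}.
Proof.
move=> cg; apply/(@cvgrPdist_le _ _ _ (nbhs x)) => e e0.
have : \forall y \near x, forall j, `|g x 0 j - g y 0 j| <= e.
  apply: (@filter_forall _ _ _ (nbhs x)) => j.
  exact: (cvgrPdist_le (F := nbhs x) _ _).1 (cg j) e e0.
apply: filterS => y ye; apply: rV_norm_le => [|j]; first exact: ltW.
by rewrite !mxE.
Qed.

Definition row_form m (c h : 'rV[R]_m) : R := \sum_(i < m) h 0 i * c 0 i.

Fact row_form_linear m (c : 'rV[R]_m) : linear (row_form c).
Proof.
move=> a u v; rewrite /row_form scaler_sumr -big_split; apply: eq_bigr => i _ /=.
by rewrite !mxE mulrDl -mulrA.
Qed.

HB.instance Definition _ m (c : 'rV[R]_m) :=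
  GRing.isLinear.Build _ _ _ _ (row_form c) (row_form_linear c).

Lemma row_form_continuous m (c : 'rV[R]_m) : continuous (row_form c).
Proof.
move=> h; apply: continuous_sum => i _.
apply: (@continuousM R _ (fun y : 'rV[R]_m => y 0 i) (cst (c 0 i))); first exact: coord_continuous.
exact: cst_continuous.
Qed.

(** Pass from [x] to [x + h] one coordinate at a time. Each of the [m] moves is governed by the mean
    value theorem and costs at most [e * |h|]. *)
Lemma increment_bound m (f : 'rV[R]_m -> R) (x h : 'rV[R]_m) (e : R) :
  (forall y, `|y - x| <= `|h| -> forall i, derivable f y (unitv R i) /\
     `|partial i f y - partial i f x| <= e) ->
  `|f (x + h) - f x - \sum_(i < m) h 0 i * partial i f x| <= m%:R * (e * `|h|).
Proof.
move=> H.
pose tr k : 'rV[R]_m := \row_i (if (i < k)%N then h 0 i else 0).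
suff IH k : (k <= m)%N ->
  `|f (x + tr k) - f x - \sum_(i < m | (i < k)%N) h 0 i * partial i f x|
     <= k%:R * (e * `|h|).
  have := IH m (leqnn m).
  have -> : tr m = h by apply/rowP => i; rewrite mxE ltn_ord.
  by under eq_bigl do rewrite ltn_ord.
elim: k => [_|k IHk km].
  rewrite mul0r big1//.
  have -> : tr 0%N = 0 by apply/rowP => i; rewrite !mxE.
  by rewrite addr0 subrr subr0 normr0.
pose j := Ordinal km.
have trS : tr k.+1 = tr k + h 0 j *: unitv R j.
  apply/rowP => i; rewrite !mxE/= eq_sym.
  have [->|ij] := eqVneq i j; first by rewrite /= ltnSn ltnn mulr1 add0r.
  rewrite mulr0 addr0 ltnS leq_eqVlt.
  by have /negbTE-> : nat_of_ord i != k by [].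
(* In the sup norm the whole path along the axes stays within [|h|] of [x], where the hypothesis
   applies. *)
have near_x t : `|t| <= `|h 0 j| -> `|x + tr k + t *: unitv R j - x| <= `|h|.
  move=> tj; apply: rV_norm_le => // i; rewrite !mxE/= eq_sym.
  rewrite addrC addrA addKr.
  have [->|ij] := eqVneq i j.
    by rewrite /= ltnn mulr1 add0r (le_trans tj)// ler_coord_norm.
  rewrite mulr0 addr0; case: ifP => _; first exact: ler_coord_norm.
  by rewrite normr0.
have [t tj Et] := @MVT_line _ f (x + tr k) (unitv R j) (h 0 j)
  (fun t tj => (H _ (near_x t tj) j).1).
rewrite (bigD1 j) ?ltnSn//=.
rewrite (eq_bigl (fun i : 'I_m => (i < k)%N)); last first.
  move=> i; rewrite ltnS leq_eqVlt; have [->|ij] := eqVneq i j.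
    by rewrite /= ltnn andbF.
  by rewrite andbT; have /negbTE-> : nat_of_ord i != k by [].
rewrite trS addrA.
set A := f (_ + _ *: _) in Et *; set B := \sum_(i < _ | _) _ in IHk *.
have -> : A - f x - (h 0 j * partial j f x + B) =
  (f (x + tr k) - f x - B) +
    ('D_(unitv R j) f (x + tr k + t *: unitv R j) - partial j f x) * h 0 j.
  rewrite mulrBl -Et; ring.
rewrite (le_trans (ler_normD _ _))// -natr1 [leRHS]mulrDl mul1r lerD ?IHk ?(ltnW km)//.
rewrite normrM ler_pM//; last exact: ler_coord_norm.
exact: (H _ (near_x t tj) j).2.
Qed.

Lemma C1_diff m (f : 'rV[R]_m -> R) (x : 'rV[R]_m) :
  (\forall y \near x, forall i, derivable f y (unitv R i)) ->
  (forall i, {for x, continuous (partial i f)}) ->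
  is_diff x f (row_form (\row_i partial i f x)).
Proof.
move=> df cf; pose L := row_form (\row_i partial i f x).
have E : f \o shift x = cst (f x) + L +o_ (0 : 'rV[R]_m) id.
  apply/eqaddoP => e e0.
  (* The denominator absorbs the factor [m] of [increment_bound]; the successor keeps it nonzero in
     dimension 0. *)
  have e1 : 0 < e / m.+1%:R by rewrite divr_gt0.
  have : \forall y \near x, forall i, derivable f y (unitv R i) /\
     `|partial i f y - partial i f x| <= e / m.+1%:R.
    near=> y => i; split; first by move: i; near: y.
    rewrite distrC; move: i; near: y; apply: filter_forall => i.
    by have /cvgrPdist_le := cf i; apply.
  move=> /nbhs_normP[d /= d0 dP].
  have : \forall h \near (0 : 'rV[R]_m), `|h| < d.
    apply/nbhs_normP; exists d => // h /=.
    by rewrite /ball_/= sub0r normrN.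
  apply: filterS => h hd /=.
  rewrite !fctE /= [h + x]addrC opprD addrA.
  have -> : L h = \sum_(i < m) h 0 i * partial i f x.
    by apply: eq_bigr => i _; rewrite mxE.
  apply: le_trans (increment_bound (e := e / m.+1%:R) _) _.
    move=> y yh; apply: dP; rewrite /ball_/= distrC.
    exact: le_lt_trans yh hd.
  rewrite mulrA ler_wpM2r// mulrCA ger_pMr// ler_pdivrMr// mul1r.
  by rewrite ler_nat.
have dE : 'd f x = L :> (_ -> _).
  by apply: diff_unique => //; exact: row_form_continuous.
split=> //.
apply/diff_locallyP; rewrite dE; split => //; exact: row_form_continuous.
Unshelve. all: by end_near. Qed.

End Differentiability.

(** * The chain rule for directional derivatives *)

Section ChainRule.
Variable R : realType.

Lemma is_derive_lineP (V W : normedModType R) (f : V -> W) (x v : V) (d : W) :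
  is_derive x v f d <-> is_derive (0 : R) (1 : R) (fun h : R => f (h *: v + x)) d.
Proof.
have E : (fun h : R => h^-1 *: (((fun h : R => f (h *: v + x)) \o shift 0) (h *: (1 : R))
    - f (0 *: v + x))) =
  (fun h : R => h^-1 *: ((f \o shift x) (h *: v) - f x)).
  apply/funext => h /=; congr (_ *: (f _ - f _)).
    by rewrite addr0 [h *: 1]mulr1.
  by rewrite scale0r add0r.
by split=> -[df dv]; split; move: df dv; rewrite /derivable /derive /= E.
Qed.

(** Only directional derivability of [g] is available. On the line through [x] along [v], [g] is a
    function of one real variable, hence differentiable, and it can be composed with [f], which is
    differentiable by [C1_diff]. *)
Lemma is_derive_chain (V : normedModType R) m (f : 'rV[R]_m -> R)
    (g : V -> 'rV[R]_m) (x v : V) :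
  (\forall y \near g x, forall i, derivable f y (unitv R i)) ->
  (forall i, {for g x, continuous (partial i f)}) ->
  (forall j, derivable (fun y => g y 0 j) x v) ->
  is_derive x v (f \o g) (\sum_(j < m) 'D_v (fun y => g y 0 j) x * partial j f (g x)).
Proof.
move=> df cf dg.
have Dg : derivable g x v by apply/derivable_mxP => i j; rewrite ord1.
have [dgl Egl] := (is_derive_lineP g x v _).1 (derivableP Dg).
have Df := C1_diff df cf.
apply/is_derive_lineP => /=.
pose gl := fun h : R => g (h *: v + x).
have gl0 : gl 0 = g x by rewrite /gl scale0r add0r.
have glD : differentiable gl 0 by exact/derivable1_diffP.
have fD : differentiable f (gl 0) by rewrite gl0.
have cD : differentiable (f \o gl) 0 by exact: differentiable_comp.
split; first exact: diff_derivable.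
have dcomp : 'd (f \o gl) 0 = 'd f (gl 0) \o 'd gl 0 :> (R -> R) := diff_comp glD fD.
have dgl1 : 'd gl 0 1 = 'D_v g x by rewrite -(deriveE _ glD); exact: Egl.
rewrite (deriveE _ cD) dcomp /= dgl1 gl0 diff_val (derive_mx Dg).
by apply: eq_bigr => j _; rewrite !mxE.
Qed.

End ChainRule.

(** * Closure properties of smooth functions *)

Section Smooth.
Variables (R : realType) (m : nat).
Implicit Types (U : set 'rV[R]_m) (f g : 'rV[R]_m -> R).

(** [iterd] adds new derivatives on the outside; here the recursion peels off the innermost one, so
    that the sum, product and chain rules can be iterated by induction on [k]. [smooth_onP]
    translates back. *)
Fixpoint Ck k U f : Prop :=
  if k is k'.+1 then
    (forall x, U x -> {for x, continuous f} /\
       forall i, derivable f x (unitv R i)) /\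
    (forall i, Ck k' U (partial i f))
  else True.

Lemma iterd_rcons l (i : 'I_m) f : iterd (rcons l i) f = iterd l (partial i f).
Proof. by rewrite /iterd foldr_rcons. Qed.

Lemma smooth_partial U f i : smooth_on U f -> smooth_on U (partial i f).
Proof. by move=> sf l x Ux; rewrite -iterd_rcons; exact: sf. Qed.

Lemma smooth_iterd U f l : smooth_on U f -> smooth_on U (iterd l f).
Proof. by move=> sf; elim: l => [|i l]; [exact: sf|exact: smooth_partial]. Qed.

Lemma smooth_continuous U f x : smooth_on U f -> U x -> {for x, continuous f}.
Proof. by move=> sf Ux; have [] := sf [::] x Ux. Qed.

Lemma smooth_derivable U f x i : smooth_on U f -> U x -> derivable f x (unitv R i).
Proof. by move=> sf Ux; have [_] := sf [::] x Ux; apply. Qed.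

Lemma smooth_onP U f : smooth_on U f <-> forall k, Ck k U f.
Proof.
split=> [sf k|Cf l x Ux].
  elim: k f sf => //= k IHk f sf; split=> [x Ux|i]; first exact: (sf [::]).
  exact/IHk/smooth_partial.
elim/last_ind: l f Cf => [|l i IHl] f Cf; first by have [+ _] := Cf 1%N; apply.
by rewrite iterd_rcons; apply: IHl => k; have [_] := Cf k.+1; apply.
Qed.

Lemma CkW k U f : Ck k.+1 U f -> Ck k U f.
Proof.
elim: k f => // k IHk f [Cf CSf]; split=> // i; apply: IHk; exact: CSf.
Qed.

Lemma smooth_subset U U' f : U `<=` U' -> smooth_on U' f -> smooth_on U f.
Proof. by move=> UU' sf l x /UU'; exact: sf. Qed.

Lemma partial_eq U f g i x : open U -> (forall y, U y -> f y = g y) -> U x ->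
  partial i f x = partial i g x.
Proof.
move=> oU fg Ux; apply: near_eq_derive.
by apply: (filterS fg); exact: open_nbhs_nbhs.
Qed.

(** The differentiation rules describe a derivative only at points of [U]; this lets their
    right-hand sides replace it. *)
Lemma Ck_eq k U f g : open U -> (forall y, U y -> f y = g y) ->
  Ck k U f -> Ck k U g.
Proof.
move=> oU; elim: k f g => // k IHk f g fg [Cf CSf]; split=> [x Ux|i]; last first.
  by apply: IHk (CSf i) => y; exact: partial_eq.
have nfg : \forall y \near x, f y = g y.
  by apply: (filterS fg); exact: open_nbhs_nbhs.
have [cf df] := Cf x Ux; split=> [|i]; last exact: near_eq_derivable (df i).
rewrite /prop_for /continuous_at -fg//.
apply: cvg_trans cf; exact: (near_eq_cvg (F := nbhs x)) nfg.
Qed.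

Lemma Ck_cst k U (c : R) : Ck k U (cst c).
Proof.
elim: k c => // k IHk c; split=> [x _|i].
  by split=> [|i]; [exact: cst_continuous|exact: derivable_cst].
suff -> : partial i (cst c) = cst 0 by exact: IHk.
by apply/funext => x; rewrite /partial derive_cst.
Qed.

Lemma CkD k U f g : open U -> Ck k U f -> Ck k U g ->
  Ck k U (fun x => f x + g x).
Proof.
move=> oU; elim: k f g => // k IHk f g [Cf CSf] [Cg CSg]; split=> [x Ux|i].
  have [cf df] := Cf x Ux; have [cg dg] := Cg x Ux.
  by split=> [|i]; [exact: continuousD|exact: (derivableD (df i) (dg i))].
apply: (Ck_eq (f := fun x => partial i f x + partial i g x)) => //;
  last exact: (IHk _ _ (CSf i) (CSg i)).
by move=> x Ux; rewrite /partial deriveD//; [have [_] := Cf x Ux|have [_] := Cg x Ux]; apply.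
Qed.

Lemma CkM k U f g : open U -> Ck k U f -> Ck k U g ->
  Ck k U (fun x => f x * g x).
Proof.
move=> oU; elim: k f g => // k IHk f g Kf Kg.
have [Cf CSf] := Kf; have [Cg CSg] := Kg; split=> [x Ux|i].
  have [cf df] := Cf x Ux; have [cg dg] := Cg x Ux.
  by split=> [|i]; [exact: continuousM|exact: (derivableM (df i) (dg i))].
apply: (Ck_eq (f := fun x => f x * partial i g x + g x * partial i f x)) => //.
  by move=> x Ux; rewrite /partial deriveM//; [have [_] := Cf x Ux|have [_] := Cg x Ux]; apply.
by apply: CkD => //; [exact: (IHk _ _ (CkW Kf) (CSg i))|exact: (IHk _ _ (CkW Kg) (CSf i))].
Qed.

Lemma Ck_sum k U (I : Type) (r : seq I) (P : pred I) (F : I -> 'rV[R]_m -> R) :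
  open U -> (forall i, P i -> Ck k U (F i)) ->
  Ck k U (fun x => \sum_(i <- r | P i) F i x).
Proof.
move=> oU CF; elim: r => [|i r IHr].
  by rewrite (_ : (fun x => _) = cst 0); [exact: Ck_cst|apply/funext => x; rewrite big_nil].
rewrite (_ : (fun x => _) = (fun x => if P i then F i x + \sum_(j <- r | P j) F j x
  else \sum_(j <- r | P j) F j x)); last by apply/funext => x; rewrite big_cons.
case Pi: (P i) => //; exact: (CkD oU (CF i Pi) IHr).
Qed.

Lemma smooth_cst U (c : R) : smooth_on U (fun=> c).
Proof. by apply/smooth_onP => k; exact: Ck_cst. Qed.

Lemma smoothD U f g : open U -> smooth_on U f -> smooth_on U g ->
  smooth_on U (fun x => f x + g x).
Proof.
move=> oU /smooth_onP Cf /smooth_onP Cg; apply/smooth_onP => k; exact: CkD.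
Qed.

Lemma smoothM U f g : open U -> smooth_on U f -> smooth_on U g ->
  smooth_on U (fun x => f x * g x).
Proof.
move=> oU /smooth_onP Cf /smooth_onP Cg; apply/smooth_onP => k; exact: CkM.
Qed.

Lemma smoothX U f d : open U -> smooth_on U f -> smooth_on U (fun x => f x ^+ d).
Proof.
move=> oU sf; elim: d => [|d IHd].
  by rewrite (_ : (fun x => _) = cst 1); [exact: smooth_cst|apply/funext => x].
rewrite (_ : (fun x => _) = (fun x => f x * f x ^+ d)); first exact: smoothM.
by apply/funext => x; rewrite exprS.
Qed.

Lemma smooth_sum U (I : Type) (r : seq I) (P : pred I) (F : I -> 'rV[R]_m -> R) :
  open U -> (forall i, P i -> smooth_on U (F i)) ->
  smooth_on U (fun x => \sum_(i <- r | P i) F i x).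
Proof.
move=> oU sF; apply/smooth_onP => k; apply: Ck_sum => // i /sF /smooth_onP; exact.
Qed.

Lemma smooth_prod U (I : Type) (r : seq I) (P : pred I) (F : I -> 'rV[R]_m -> R) :
  open U -> (forall i, P i -> smooth_on U (F i)) ->
  smooth_on U (fun x => \prod_(i <- r | P i) F i x).
Proof.
move=> oU sF; elim: r => [|i r IHr].
  by rewrite (_ : (fun x => _) = cst 1); [exact: smooth_cst|apply/funext => x; rewrite big_nil].
rewrite (_ : (fun x => _) = (fun x => if P i then F i x * \prod_(j <- r | P j) F j x
  else \prod_(j <- r | P j) F j x)); last by apply/funext => x; rewrite big_cons.
by case Pi: (P i); [exact: (smoothM oU (sF i Pi) IHr)|exact: IHr].
Qed.

Lemma is_derive_coord (x : 'rV[R]_m) i j :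
  is_derive x (unitv R i) (fun y : 'rV[R]_m => y 0 j) (i == j)%:R.
Proof.
have idD := @derivable_id R 'rV[R]_m x (unitv R i).
split; first exact: ((derivable_mxP _ _ _).1 idD 0 j).
have := @derive_id R 'rV[R]_m x (unitv R i); rewrite derive_mx//.
move/rowP/(_ j); rewrite mxE => ->.
by rewrite /unitv mxE eqxx /= eq_sym.
Qed.

Lemma smooth_coord U (j : 'I_m) : smooth_on U (fun x => x 0 j).
Proof.
apply/smooth_onP => -[//|k]; split=> [x _|i].
  split=> [|i]; first exact: coord_continuous.
  by have [] := is_derive_coord x i j.
suff -> : partial i (fun x : 'rV[R]_m => x 0 j) = cst (i == j)%:R by exact: Ck_cst.
by apply/funext => x; have [_] := is_derive_coord x i j.
Qed.

End Smooth.

Section SmoothComp.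
Variables (R : realType) (m N : nat).

Lemma smooth_chain (U : set 'rV[R]_N) (f : 'rV[R]_N -> R) (V : normedModType R)
    (g : V -> 'rV[R]_N) (x v : V) :
  open U -> U (g x) -> smooth_on U f ->
  (forall j, derivable (fun y => g y 0 j) x v) ->
  is_derive x v (f \o g) (\sum_(j < N) 'D_v (fun y => g y 0 j) x * partial j f (g x)).
Proof.
move=> oU Ugx sf dg; apply: is_derive_chain; last exact: dg.
  apply: (@filterS _ (nbhs (g x)) _ U); last exact: open_nbhs_nbhs.
  by move=> y Uy i; exact: smooth_derivable sf Uy.
by move=> i; apply: smooth_continuous Ugx; exact: smooth_partial.
Qed.

(** The induction on [k] is uniform in [f], because the chain rule produces the composites
    [partial j f \o g]. *)
Lemma smooth_comp (U : set 'rV[R]_m) (f : 'rV[R]_N -> R) (g : 'rV[R]_m -> 'rV[R]_N) :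
  open U -> smooth_on [set: 'rV[R]_N] f ->
  (forall j, smooth_on U (fun y => g y 0 j)) -> smooth_on U (f \o g).
Proof.
move=> oU sf sg; apply/smooth_onP => k; elim: k f sf => // k IHk f sf.
have D i x : U x -> is_derive x (unitv R i) (f \o g)
    (\sum_(j < N) 'D_(unitv R i) (fun y => g y 0 j) x * partial j f (g x)).
  move=> Ux; apply: (smooth_chain (U := setT)) => //; first exact: openT.
  by move=> j; exact: smooth_derivable (sg j) Ux.
split=> [x Ux|i].
  split=> [|i]; last by have [] := D i x Ux.
  apply: (@continuous_comp _ _ _ g f); last exact: smooth_continuous sf _.
  by apply: rV_continuous => j; exact: smooth_continuous (sg j) Ux.
apply: (@Ck_eq _ _ k U (fun x => \sum_(j < N) partial i (fun y => g y 0 j) x *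
  (partial j f \o g) x)) => //.
  by move=> x /D /= /(_ i)[_].
apply: Ck_sum => // j _; apply: CkM => //; last exact/IHk/smooth_partial.
by have /smooth_onP := smooth_partial i (sg j); exact.
Qed.

End SmoothComp.

(** * Coefficients and main symbols of operators *)

Section MultiIndex.
Variables (R : realType) (n b : nat).
Implicit Type alpha : {ffun 'I_n -> 'I_b}.

(** Spelling a multi-index as a word of directions reduces statements about [dmulti] to inductions
    on lists. *)
Definition mseq alpha : seq 'I_n := flatten [seq nseq (alpha i) i | i <- enum 'I_n].

Lemma dmultiE alpha (f : 'rV[R]_n -> R) : dmulti alpha f = iterd (mseq alpha) f.
Proof.
rewrite /dmulti /mseq; elim: (enum _) => //= i s ->.
rewrite /iterd foldr_cat; elim: (nat_of_ord (alpha i)) => //= k -> //.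
Qed.

Lemma size_mseq alpha : size (mseq alpha) = mabs alpha.
Proof.
rewrite /mseq /mabs size_flatten /shape -map_comp sumnE big_map big_enum/=.
by apply: eq_bigr => i _; rewrite size_nseq.
Qed.

Lemma count_mseq alpha i : count_mem i (mseq alpha) = alpha i.
Proof.
rewrite /mseq count_flatten -map_comp sumnE big_map big_enum/= (bigD1 i)//=.
rewrite count_nseq/= eqxx mul1n big1 ?addn0// => j ji.
by rewrite count_nseq /= (negbTE ji).
Qed.

Lemma prod_mseq alpha (p : 'rV[R]_n) :
  \prod_(i <- mseq alpha) p 0 i = \prod_(i < n) p 0 i ^+ alpha i.
Proof.
rewrite /mseq big_flatten big_map big_enum/=; apply: eq_bigr => i _.
by rewrite big_nseq -Monoid.iteropE.
Qed.

End MultiIndex.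

Section Coefficients.
Variable R : realType.

(* The a-th derivative of r ^+ e / e`!; no case distinction is then needed when
   differentiating once more. *)
Definition divpow (e a : nat) (r : R) : R :=
  if (a <= e)%N then r ^+ (e - a) / (e - a)`!%:R else 0.

Lemma is_derive_divpow e a r : is_derive r (1 : R) (divpow e a) (divpow e a.+1 r).
Proof.
rewrite /divpow; have [ae|ea] := ltnP e a.
  by rewrite ltnNge (ltnW ae)/=; exact: is_derive_cst.
case: (ltngtP a e) ea => // [ae _|-> _]; last first.
  by rewrite subnn; exact: (is_derive_cst (r ^+ 0 / 0`!%:R) r 1).
rewrite -(subnSK ae); set k := (e - a.+1)%N.
have -> : (fun r : R => r ^+ k.+1 / k.+1`!%:R) =
   (k.+1`!%:R)^-1 \*: ((@id R) ^+ k.+1).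
  by apply/funext => x; rewrite mulrC exprfctE.
have H := is_deriveX k.+1 (is_derive_id r (1 : R)).
apply: is_derive_eq (is_deriveZ (k.+1`!%:R)^-1 H) _.
rewrite factS natrM /= ![_ *: _]mulrA mulr1; field.
by rewrite nat1r !pnatr_eq0 -lt0n fact_gt0.
Qed.

Lemma divpow0 e a : divpow e a 0 = (a == e)%:R.
Proof.
rewrite /divpow; case: (ltngtP a e) => [ae|//|->].
  by rewrite -(subnSK ae) expr0n mul0r.
by rewrite subnn divr1.
Qed.

Variable n : nat.

(** The derivative of multi-order [a] of the normalized monomial [(y - x)^e / e!]. Carrying [a]
    along makes the family stable under [partial]. *)
Definition test_monomial (x : 'rV[R]_n) (e a : 'I_n -> nat) (y : 'rV[R]_n) : R :=
  \prod_(j < n) divpow (e j) (a j) (y 0 j - x 0 j).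

Lemma smooth_test_monomial x e a :
  smooth_on [set: 'rV[R]_n] (test_monomial x e a).
Proof.
have oT : open [set: 'rV[R]_n] by exact: openT.
apply: (smooth_prod _ oT) => j _; rewrite /divpow; case: (a j <= e j)%N; last exact: smooth_cst.
apply: (smoothM oT); last exact: smooth_cst.
apply: (smoothX _ oT); apply: (smoothD oT); last exact: smooth_cst.
exact: smooth_coord.
Qed.

Lemma partial_test_monomial x e a i :
  partial i (test_monomial x e a) =
  test_monomial x e (fun j => ((i == j) + a j)%N).
Proof.
apply/funext => y; rewrite /partial.
suff H : is_derive (0 : R) (1 : R)
    (fun h : R => test_monomial x e a (h *: unitv R i + y))
    (test_monomial x e (fun j => ((i == j) + a j)%N) y).
  by have [] := (is_derive_lineP _ _ _ _).2 H.
(* Along direction [i] only the factor of index [i] varies; [C] collects the others. *)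
pose C := \prod_(j < n | j != i) divpow (e j) (a j) (y 0 j - x 0 j).
have -> : (fun h : R => test_monomial x e a (h *: unitv R i + y)) =
   C \*: (fun h : R => divpow (e i) (a i) (h *: (1 : R) + (y 0 i - x 0 i))).
  apply/funext => h; rewrite /= [h *: (1 : R)]mulr1 /test_monomial (bigD1 i)//=.
  rewrite mulrC !mxE !eqxx mulr1 addrA.
  congr (_ * _); apply: eq_bigr => j ji.
  by rewrite !mxE (negbTE ji) mulr0 add0r.
have -> : test_monomial x e (fun j => ((i == j) + a j)%N) y =
   C *: divpow (e i) (a i).+1 (y 0 i - x 0 i).
  rewrite /test_monomial (bigD1 i)//= mulrC eqxx add1n.
  by congr (_ * _); apply: eq_bigr => j ji; rewrite eq_sym (negbTE ji).
apply: is_deriveZ; exact: (is_derive_lineP _ _ _ _).1 (is_derive_divpow _ _ _).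
Qed.

Lemma iterd_test_monomial x e l :
  iterd l (test_monomial x e (fun=> 0%N)) =
  test_monomial x e (fun j => count_mem j l).
Proof.
elim: l => //= i l ->; rewrite partial_test_monomial.
by congr test_monomial; apply/funext => j; rewrite eq_sym.
Qed.

(** At [x], the derivative of multi-order [b] of [(y - x)^e / e!] is 1 if [b = e] and 0 otherwise,
    so exactly one coefficient survives. This gives the uniqueness of coefficients. *)
Lemma op_apply_test_monomial (F : Op R n) (e : {ffun 'I_n -> 'I_(op_bnd F).+1}) x :
  op_apply F (test_monomial x (fun j => e j) (fun=> 0%N)) x = @op_coef R n F e x.
Proof.
rewrite /op_apply (bigD1 e)//= big1 => [|b be].
  rewrite addr0 dmultiE iterd_test_monomial /test_monomial big1 ?mulr1// => j _.
  by rewrite count_mseq subrr divpow0 eqxx.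
rewrite dmultiE iterd_test_monomial.
have /existsP[j bej] : [exists j, b j != e j].
  rewrite -negb_forall; apply: contra be => /forallP be.
  by apply/eqP/ffunP => j; exact/eqP.
rewrite /test_monomial (bigD1 j)//= count_mseq subrr divpow0.
by have /negbTE-> : nat_of_ord (b j) != e j by []; rewrite mul0r mulr0.
Qed.

Lemma op_coef_eq0 (K : set 'rV[R]_n) (F : Op R n) alpha x :
  ~ op_nz K F -> K x -> @op_coef R n F alpha x = 0.
Proof.
move=> F0 Kx; apply: contrapT => Fx; apply: F0.
exists (test_monomial x (fun j => alpha j) (fun=> 0%N)); split.
  by apply: smooth_subset (smooth_test_monomial _ _ _).
by exists x; split => //; rewrite op_apply_test_monomial.
Qed.

Lemma op_coef_gt_ord (K : set 'rV[R]_n) (F : Op R n) alpha x :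
  K x -> (ord K F < mabs alpha)%N -> @op_coef R n F alpha x = 0.
Proof.
move=> Kx Falpha.
(* Each of the [n] entries is at most [op_bnd F], so this degree lies in the range of the maximum
   defining [ord]. *)
have lt_mabs : (mabs alpha < (op_bnd F * n).+1)%N.
  rewrite ltnS /mabs -[leqRHS]mulnC -[X in (X * _)%N]card_ord -sum_nat_const.
  by apply: leq_sum => i _; rewrite -ltnS.
have nz : ~ op_nz K (Hg F (mabs alpha)).
  move=> nz; move: Falpha; rewrite ltnNge => /negP; apply.
  apply: (@leq_bigmax_cond _ _ (fun g => nat_of_ord g) (Ordinal lt_mabs)).
  exact/asboolP.
by have := @op_coef_eq0 K (Hg F (mabs alpha)) alpha x nz Kx; rewrite /= eqxx.
Qed.

(** Removes the case distinction of [msym]: a zero operator has zero coefficients on [K], so both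
    branches agree there. *)
Lemma msymE (K : set 'rV[R]_n) (F : Op R n) x p :
  K x -> msym K F x p = symbol (Hg F (ord K F)) x p.
Proof.
move=> Kx; rewrite /msym; case: asboolP => // F0.
rewrite /symbol big1// => alpha _ /=.
by case: ifP => _; rewrite ?(op_coef_eq0 _ F0 Kx) mul0r.
Qed.

(** Only the zero multi-index has degree 0. Thus the main symbol of an operator of order 0 is the
    function that [gvec] substitutes for its commuting variable. *)
Lemma symbol_Hg0 (F : Op R n) x p :
  symbol (Hg F 0) x p = @op_coef R n F [ffun => ord0] x.
Proof.
rewrite /symbol (bigD1 [ffun => ord0])//=.
rewrite [X in _ + X]big1 => [|alpha alpha0]; last first.
  case: eqP => [mabs0|_]; last by rewrite mul0r.
  case/eqP: alpha0; apply/ffunP => i; rewrite ffunE; apply/val_inj/eqP => /=.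
  by move/eqP: mabs0; rewrite /mabs sum_nat_eq0 => /forallP/(_ i).
have -> : mabs ([ffun=> ord0] : {ffun 'I_n -> 'I_(op_bnd F).+1}) = 0%N.
  by apply: big1 => i _; rewrite ffunE.
by rewrite eqxx addr0 big1 ?mulr1// => i _; rewrite ffunE.
Qed.

End Coefficients.

(** * Operators on test functions *)

Lemma is_derive_bigsum (R : realType) (V : normedModType R) (I : Type) (r : seq I)
    (P : pred I) (F : I -> V -> R) (d : I -> R) (x v : V) :
  (forall k, is_derive x v (F k) (d k)) ->
  is_derive x v (fun y => \sum_(k <- r | P k) F k y) (\sum_(k <- r | P k) d k).
Proof.
move=> dF; rewrite (_ : (fun y => _) = \sum_(k <- r | P k) F k); last first.
  by apply/funext => y; rewrite fct_sumE.
by elim/big_ind2 : _ => // [|f df g dg]; [exact: is_derive_cst|exact: is_deriveD].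
Qed.

Section Iterd.
Variables (R : realType) (m : nat) (U : set 'rV[R]_m).
Hypothesis oU : open U.

Lemma iterd_eq l (f g : 'rV[R]_m -> R) x :
  (forall y, U y -> f y = g y) -> U x -> iterd l f x = iterd l g x.
Proof.
by move=> fg; elim: l x => [|i l IHl] x Ux; [exact: fg|exact: (partial_eq i oU)].
Qed.

Lemma iterd_lincomb l (I : finType) (c : I -> R) (u : I -> 'rV[R]_m -> R) x :
  (forall k, smooth_on U (u k)) -> U x ->
  iterd l (fun y => \sum_k c k * u k y) x = \sum_k c k * iterd l (u k) x.
Proof.
move=> su; elim: l x => [//|i l IHl] x Ux /=.
rewrite (partial_eq i oU IHl Ux) /partial.
have sul k : smooth_on U (iterd l (u k)) by exact: smooth_iterd.
have [|_ ->//] := @is_derive_bigsum _ _ _ (index_enum I) xpredT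
  (fun k y => c k * iterd l (u k) y) (fun k => c k * partial i (iterd l (u k)) x)
  x (unitv R i).
by move=> k; apply: is_deriveZ; apply/derivableP; exact: smooth_derivable (sul k) Ux.
Qed.

Lemma smooth_op_apply (F : Op R m) u :
  classO U F -> smooth_on U u -> smooth_on U (op_apply F u).
Proof.
move=> sF su; apply: (smooth_sum _ oU) => alpha _; apply: (smoothM oU); first exact: sF.
by rewrite dmultiE; exact: smooth_iterd.
Qed.

Lemma op_apply_eq (F : Op R m) (f g : 'rV[R]_m -> R) x :
  (forall y, U y -> f y = g y) -> U x -> op_apply F f x = op_apply F g x.
Proof.
move=> fg Ux; apply: eq_bigr => alpha _; rewrite !dmultiE; congr (_ * _).
exact: iterd_eq.
Qed.

Lemma op_apply_lincomb (F : Op R m) (I : finType) (c : I -> R)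
    (u : I -> 'rV[R]_m -> R) x :
  (forall k, smooth_on U (u k)) -> U x ->
  op_apply F (fun y => \sum_k c k * u k y) x = \sum_k c k * op_apply F (u k) x.
Proof.
move=> su Ux; rewrite /op_apply; under [RHS]eq_bigr do rewrite mulr_sumr.
rewrite exchange_big; apply: eq_bigr => alpha _ /=.
rewrite dmultiE iterd_lincomb// mulr_sumr; apply: eq_bigr => k _.
by rewrite dmultiE mulrCA.
Qed.

End Iterd.

(** * Leading terms of operators acting on powers of a linear phase *)

Section Leading.
Variables (R : realType) (n : nat) (U : set 'rV[R]_n) (x0 p : 'rV[R]_n).
Hypotheses (oU : open U) (Ux0 : U x0).

Definition phase (y : 'rV[R]_n) : R := \sum_(i < n) p 0 i * (y 0 i - x0 0 i).

(** Dividing by the factorial makes each derivative lower [k] by one with factor [p 0 i] only, so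
    that symbols appear without numerical constants. *)
Definition phase_pow k (y : 'rV[R]_n) : R := phase y ^+ k / k`!%:R.

(* An operator of order m lowers k by m and multiplies c by its main symbol at (x0, p). *)
Definition lead k (c : R) (u : 'rV[R]_n -> R) : Prop :=
  exists2 g, smooth_on U g & g x0 = c /\ forall y, U y -> u y = phase_pow k y * g y.

Lemma phase_x0 : phase x0 = 0.
Proof. by apply: big1 => i _; rewrite subrr mulr0. Qed.

Lemma smooth_phase (V : set 'rV[R]_n) : open V -> smooth_on V phase.
Proof.
move=> oV; apply: (smooth_sum _ oV) => i _; apply: (smoothM oV); first exact: smooth_cst.
by apply: (smoothD oV); [exact: smooth_coord|exact: smooth_cst].
Qed.

Lemma smooth_phase_pow (V : set 'rV[R]_n) k : open V -> smooth_on V (phase_pow k).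
Proof.
move=> oV; apply: (smoothM oV); last exact: smooth_cst.
by apply: (smoothX _ oV); exact: smooth_phase.
Qed.

Lemma partial_phase_pow k i y :
  partial i (phase_pow k.+1) y = p 0 i * phase_pow k y.
Proof.
have dphi : is_derive y (unitv R i) phase (p 0 i).
  have := @is_derive_bigsum _ _ _ (index_enum 'I_n) xpredT
    (fun j (z : 'rV[R]_n) => p 0 j * (z 0 j - x0 0 j)) (fun j => p 0 j * (i == j)%:R) y (unitv R i).
  rewrite [X in is_derive _ _ _ X](bigD1 i)//= eqxx mulr1 big1 ?addr0 => [|j ji].
    apply=> j; apply: is_deriveZ; rewrite -[X in is_derive _ _ _ X]addr0.
    by apply: is_deriveD; exact: is_derive_coord.
  by rewrite eq_sym (negbTE ji) mulr0.
have H := is_deriveX k.+1 dphi.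
have [_] := is_deriveZ (k.+1`!%:R)^-1 H.
rewrite (_ : _ \*: _ = phase_pow k.+1); last first.
  by apply/funext => z; rewrite /phase_pow [RHS]mulrC exprfctE.
rewrite /partial => ->; rewrite /phase_pow factS natrM /= ![_ *: _]mulrA; field.
by rewrite nat1r !pnatr_eq0 -lt0n fact_gt0.
Qed.

Lemma lead_pow k : lead k 1 (phase_pow k).
Proof.
exists (fun=> 1); first exact: smooth_cst.
by split=> // y _; rewrite mulr1.
Qed.

Lemma lead_eq k c u v : (forall y, U y -> u y = v y) -> lead k c u -> lead k c v.
Proof.
by move=> uv [g sg [gx ug]]; exists g => //; split=> // y Uy; rewrite -uv// ug.
Qed.

Lemma lead_sum k (I : finType) (c : I -> R) (u : I -> 'rV[R]_n -> R) :
  (forall j, lead k (c j) (u j)) ->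
  lead k (\sum_j c j) (fun y => \sum_j u j y).
Proof.
move=> Lu.
have /choice[g gP] : forall j, exists g, [/\ smooth_on U g, g x0 = c j &
    forall y, U y -> u j y = phase_pow k y * g y].
  by move=> j; have [g sg [gx ug]] := Lu j; exists g.
exists (fun y => \sum_j g j y); first by apply: (smooth_sum _ oU) => j _; case: (gP j).
split=> [|y Uy]; first by apply: eq_bigr => j _; case: (gP j).
by rewrite mulr_sumr; apply: eq_bigr => j _; case: (gP j) => _ _; exact.
Qed.

Lemma lead_mul k c f u : smooth_on U f -> lead k c u ->
  lead k (f x0 * c) (fun y => f y * u y).
Proof.
move=> sf [g sg [<- ug]]; exists (fun y => f y * g y); first exact: smoothM.
by split=> // y Uy; rewrite ug// mulrCA.
Qed.

(** The [j] surplus powers of the phase move into the cofactor, which then vanishes at [x0]. This is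
    how terms of lower order drop out. *)
Lemma leadW k j c u : (0 < j)%N -> lead (j + k) c u -> lead k 0 u.
Proof.
move=> j0 [g sg [gx ug]].
exists (fun y => phase y ^+ j * (k`!%:R / (j + k)`!%:R) * g y).
  apply: (smoothM oU) sg; apply: (smoothM oU); last exact: smooth_cst.
  by apply: (smoothX _ oU); exact: smooth_phase.
split=> [|y Uy]; first by rewrite phase_x0 expr0n gtn_eqF// !mul0r.
rewrite ug// /phase_pow exprD; field.
by rewrite !pnatr_eq0 -!lt0n !fact_gt0.
Qed.

Lemma lead_partial k c u i : lead k.+1 c u -> lead k (p 0 i * c) (partial i u).
Proof.
move=> [g sg [<- ug]].
(* This cofactor comes from the product rule: the term in which [g] is differentiated keeps one
   power of the phase too many, and so contributes nothing at [x0]. *)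
exists (fun y => p 0 i * g y + phase y * (k.+1%:R^-1 * partial i g y)).
  apply: (smoothD oU); first by apply: (smoothM oU) sg; exact: smooth_cst.
  apply: (smoothM oU); first exact: smooth_phase.
  by apply: (smoothM oU); [exact: smooth_cst|exact: smooth_partial].
split=> [|y Uy]; first by rewrite phase_x0 mul0r addr0.
rewrite (partial_eq i oU ug Uy) /partial deriveM; last 2 first.
- exact: smooth_derivable (smooth_phase_pow _ oU) Uy.
- exact: smooth_derivable sg Uy.
rewrite -!/(partial _ _ _) partial_phase_pow /phase_pow exprS factS natrM.
rewrite /GRing.scale /=; field.
by rewrite nat1r !pnatr_eq0 -!lt0n fact_gt0.
Qed.

Lemma lead_iterd k c u l : lead (size l + k) c u ->
  lead k (\prod_(i <- l) p 0 i * c) (iterd l u).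
Proof.
elim: l k => [|i l IHl] k; first by rewrite big_nil mul1r.
rewrite big_cons -mulrA /= addSnnS => /IHl; exact: lead_partial.
Qed.

Lemma lead_cst0 k : lead k 0 (fun=> 0).
Proof.
by exists (fun=> 0); [exact: smooth_cst|split=> // y _; rewrite mulr0].
Qed.

(** Terms of degree below [m] leave surplus powers of the phase, those above [m] have zero
    coefficients, and those of degree [m] add up to the symbol. *)
Lemma lead_op_apply (F : Op R n) m k c u : classO U F ->
  (forall alpha x, U x -> (m < mabs alpha)%N -> @op_coef R n F alpha x = 0) ->
  lead (m + k) c u -> lead k (symbol (Hg F m) x0 p * c) (op_apply F u).
Proof.
move=> sF Fm Lu; rewrite /symbol mulr_suml; apply: lead_sum => alpha /=.
rewrite dmultiE -prod_mseq.
case: (ltngtP (mabs alpha) m) => [lt_m|gt_m|eq_m].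
- rewrite !mul0r -(mulr0 (@op_coef R n F alpha x0)); apply: lead_mul; first exact: sF.
  rewrite -(mulr0 (\prod_(i <- mseq alpha) p 0 i)); apply: lead_iterd.
  apply: (@leadW _ (m - mabs alpha) c); first by rewrite subn_gt0.
  by rewrite addnA size_mseq subnK ?(ltnW lt_m).
- rewrite !mul0r; apply: lead_eq (lead_cst0 k) => y Uy.
  by rewrite Fm// mul0r.
- rewrite -mulrA; apply: lead_mul; first exact: sF.
  by apply: lead_iterd; rewrite size_mseq eq_m.
Qed.

Lemma lead_val0 c u : lead 0 c u -> u x0 = c.
Proof. by move=> [g sg [<- ->]]//; rewrite /phase_pow expr0 divr1 mul1r. Qed.

Lemma lead_valS k c u : (0 < k)%N -> lead k c u -> u x0 = 0.
Proof.
by move=> k0 [g sg [_ ->]]//; rewrite /phase_pow phase_x0 expr0n gtn_eqF// !mul0r.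
Qed.

End Leading.

(** * Noncommutative polynomials *)

Section PolyAction.
Variables (R : realType) (n N : nat) (K U : set 'rV[R]_n) (T : 'I_N -> Op R n).
Hypotheses (oU : open U) (UK : U `<=` K) (sT : classO_tuple K T).

Notation term := ('I_N * ('rV[R]_N -> R))%type.

Definition wf_rest (rest : seq term) : Prop :=
  foldr (fun bz P => (~~ commuting K T bz.1 /\ wf_fun K T bz.2) /\ P) True rest.

Lemma classO_U k : classO U (T k).
Proof. by move=> alpha; apply: smooth_subset UK _; exact: sT. Qed.

Lemma smooth_coef_gvec (Z : 'rV[R]_N -> R) :
  wf_fun K T Z -> smooth_on U (fun x => Z (gvec K T x)).
Proof.
move=> [sZ _]; apply: (smooth_comp (f := Z)) => // j.
rewrite (_ : (fun y => _) = if commuting K T j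
    then @op_coef R n (T j) [ffun => ord0] else cst 0); last first.
  by apply/funext => y; rewrite mxE; case: ifP.
by case: ifP => _; [exact: classO_U|exact: smooth_cst].
Qed.

Lemma smooth_act_rest rest psi : wf_rest rest -> smooth_on U psi ->
  smooth_on U (act_rest K T rest psi).
Proof.
move=> + spsi; elim: rest => [_|[b Z] rs IHrs [[_ wZ] wrs]]; first exact: spsi.
apply: (smooth_op_apply oU); first exact: classO_U.
by apply: (smoothM oU); [exact: smooth_coef_gvec|exact: IHrs].
Qed.

Lemma prodZ_shift (rest : seq term) (y y' : nat -> 'rV[R]_N) k k' :
  (forall j, y (k + j)%N = y' (k' + j)%N) -> prodZ rest y k = prodZ rest y' k'.
Proof.
elim: rest k k' => //= bz rs IHrs k k' yy'.
have := yy' 0%N; rewrite !addn0 => ->; congr (_ * _); apply: IHrs => j.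
by rewrite !addSnnS.
Qed.

(* Freezing the first argument at w reduces to a shorter word; as the conclusion then
   holds for every w, one may put w := gvec x afterwards. *)
Lemma act_rest_eq0 (b : seq 'I_N) (I : finType) (c : I -> R) (rest : I -> seq term)
    psi x :
  (forall i, map fst (rest i) = b) -> (forall i, wf_rest (rest i)) ->
  smooth_on U psi -> (forall y, \sum_i c i * prodZ (rest i) y 0 = 0) ->
  U x -> \sum_i c i * act_rest K T (rest i) psi x = 0.
Proof.
move=> + + spsi; elim: b c rest x => [|b0 b IHb] c rest x rb wf c0 Ux.
  have r0 i : rest i = [::] by case: (rest i) (rb i).
  have /eqP := c0 (fun=> 0); rewrite (eq_bigr c) => [/eqP sc|i _]; last first.
    by rewrite r0 mulr1.
  by rewrite (eq_bigr (fun i => c i * psi x)) => [|i _]; rewrite -?mulr_suml ?sc ?mul0r ?r0.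
have /choice[Z /choice[rs rZ]] i : exists Z rs, rest i = (b0, Z) :: rs.
  by case: (rest i) (rb i) => [//|[b' Z] rs] /= [-> _]; exists Z, rs.
pose u i y := Z i (gvec K T y) * act_rest K T (rs i) psi y.
have wfZ i : wf_fun K T (Z i) by have := wf i; rewrite rZ => -[[]].
have wfr i : wf_rest (rs i) by have := wf i; rewrite rZ => -[].
have su i : smooth_on U (u i).
  by apply: (smoothM oU); [exact: smooth_coef_gvec|exact: smooth_act_rest].
under eq_bigr do rewrite rZ /= -/(u _).
(* All words begin with [b0], so [T b0] comes out of the sum by linearity. The inner combination
   vanishes on [U], and is replaced by the one with zero coefficients. *)
rewrite -(op_apply_lincomb oU _ c su Ux).
rewrite (op_apply_eq oU _ (g := fun y => \sum_(i : I) 0 * u i y) _ Ux).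
  by rewrite (op_apply_lincomb oU _ (fun=> 0) su Ux) big1// => i _; rewrite mul0r.
move=> y Uy; rewrite [RHS]big1 => [|i _]; last by rewrite mul0r.
under eq_bigr do rewrite /u mulrA.
apply: (IHb (fun i => c i * Z i (gvec K T y))) => //.
- by move=> i; have := rb i; rewrite rZ => -[].
- move=> z; rewrite -[RHS](c0 (fun j => if j is j'.+1 then z j' else gvec K T y)).
  apply: eq_bigr => i _; rewrite rZ /= mulrA; congr (_ * _).
  by apply: prodZ_shift => j.
Qed.

(** Setting the first argument of the formal identity to [gvec K T x] turns the values of [m_Z0]
    into the constants [c] of [act_rest_eq0]. *)
Lemma Sbeta_zero_act (S : Defs.Poly R N) b psi x :
  wf_poly K T S -> Sbeta_zero S b -> smooth_on U psi -> U x ->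
  \sum_(m <- S | beta m == b) m_Z0 m (gvec K T x) * act_rest K T (m_rest m) psi x = 0.
Proof.
move=> wS S0 spsi Ux; set S' := [seq m <- S | beta m == b].
have /all_tnthP allS' : all (fun m => `[< wf_mono K T m >] && (beta m == b)) (in_tuple S').
  rewrite /= /S'; elim: S wS {S' S0} => //= m S IHS [wm wS].
  case: ifP => [mb|_]; last exact: IHS.
  by rewrite /= mb IHS// !andbT; exact/asboolP.
have wS' i : wf_mono K T (tnth (in_tuple S') i) /\ beta (tnth (in_tuple S') i) = b.
  by have /andP[/asboolP ? /eqP ?] := allS' i.
rewrite -big_filter -/S' big_tnth.
apply: (act_rest_eq0 (b := b) (c := fun i => m_Z0 (tnth (in_tuple S') i) (gvec K T x))) => //.
- by move=> i; have [_] := wS' i.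
- by move=> i; have [[]] := wS' i.
- move=> y; rewrite -[RHS](S0 (fun j => if j is j'.+1 then y j' else gvec K T x)).
  rewrite -[RHS]big_filter -/S' [RHS]big_tnth; apply: eq_bigr => i _.
  by congr (_ * _); apply: prodZ_shift => j.
Qed.

End PolyAction.

(** Strong induction on the length of [s], removing the fibre of its head. It serves to group
    monomials both by word and by weight. *)
Lemma sum_fibers_eq0 (V : nmodType) (I : Type) (B : eqType) (f : I -> B)
    (s : seq I) (a : I -> V) :
  (forall b, \sum_(i <- s | f i == b) a i = 0) -> \sum_(i <- s) a i = 0.
Proof.
have [k] := ubnP (size s); elim: k s => // k IHk [|i0 s] sk H; first by rewrite big_nil.
rewrite (bigID (fun i => f i == f i0)) /= H add0r -big_filter; apply: IHk.
  by rewrite /= eqxx /= size_filter (leq_ltn_trans (count_size _ _)).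
move=> b; rewrite big_filter_cond; have [->|bf] := eqVneq b (f i0).
  by rewrite big_pred0// => i; rewrite andNb.
rewrite -[RHS](H b); apply: eq_bigl => i.
by case: (eqVneq (f i) b) => [->|]; rewrite ?bf ?andbF.
Qed.

Lemma leq_bigmax_has (I : Type) (s : seq I) (P : pred I) (F : I -> nat) w :
  has (fun i => P i && (F i == w)) s -> (w <= \max_(i <- s | P i) F i)%N.
Proof.
elim: s => //= i s IHs; rewrite big_cons => /orP[/andP[-> /eqP->]|/IHs ws].
  exact: leq_maxl.
by case: ifP => // _; exact: leq_trans ws (leq_maxr _ _).
Qed.

(** * The abelianized main part vanishes on the main symbols *)

Section MainSymbol.
Variables (R : realType) (n N : nat) (K U : set 'rV[R]_n) (T : 'I_N -> Op R n).
Hypotheses (oU : open U) (UK : U `<=` K) (sT : classO_tuple K T).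

Definition msyms (x p : 'rV[R]_n) : 'rV[R]_N := \row_k msym K (T k) x p.

(** [Z] sees only the commuting coordinates, where the main symbol coincides with the operator's
    coefficient. *)
Lemma wf_fun_msyms Z x p : wf_fun K T Z -> K x -> Z (msyms x p) = Z (gvec K T x).
Proof.
move=> [_ ZP] Kx; apply: ZP => k ck; rewrite !mxE ck msymE//.
by move/eqP: ck => ->; rewrite symbol_Hg0.
Qed.

(** Each letter of the word uses up as many powers of the phase as its order and contributes its
    coefficient function times its main symbol. *)
Lemma lead_act_rest x p rest k psi : U x -> wf_rest K T rest -> smooth_on U psi ->
  lead U x p ((\sum_(bz <- rest) ord K (T bz.1)) + k) 1 psi ->
  lead U x p k (\prod_(bz <- rest) (bz.2 (gvec K T x) * msym K (T bz.1) x p))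
    (act_rest K T rest psi).
Proof.
move=> Ux + spsi; elim: rest k => [|[b Z] rs IHrs] k; first by rewrite !big_nil.
rewrite !big_cons /= => -[[_ wZ] wrs] L.
rewrite mulrAC mulrC msymE; last exact: UK.
apply: (lead_op_apply oU); first exact: (classO_U UK sT).
  by move=> alpha y Uy; apply: op_coef_gt_ord; exact: UK.
apply: (lead_mul oU); first exact: smooth_coef_gvec.
by apply: IHrs => //; rewrite addnA [X in (X + k)%N]addnC.
Qed.

Lemma eq_sum_wf (S : Defs.Poly R N) (P : pred (Mono R N)) (F G : Mono R N -> R) :
  wf_poly K T S -> (forall m, wf_mono K T m -> P m -> F m = G m) ->
  \sum_(m <- S | P m) F m = \sum_(m <- S | P m) G m.
Proof.
move=> + FG; elim: S => [|m S IHS]; first by rewrite !big_nil.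
by move=> [wm wS]; rewrite !big_cons IHS//; case: ifP => // Pm; rewrite FG.
Qed.

Lemma wf_poly_filter (S : Defs.Poly R N) (P : pred (Mono R N)) :
  wf_poly K T S -> wf_poly K T [seq m <- S | P m].
Proof. by elim: S => //= m S IHS [wm wS]; case: ifP => _; [split => //|]; exact: IHS. Qed.

(** A component that is not formally zero contains a monomial of weight [w], and [w] then enters the
    maximum defining [degw]. *)
Lemma poly_zero_gt_degw (S : Defs.Poly R N) w :
  (degw K T S < w)%N -> poly_zero (Cd K T w S).
Proof.
move=> dw; apply: contrapT => nz; move: dw; rewrite ltnNge => /negP; apply.
apply: leq_bigmax_has; apply: contrapT => /negP nohas; apply: (nz) => b y.
rewrite /Cd (_ : [seq m <- S | _] = [::]) ?big_nil//; apply/size0nil/eqP.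
rewrite size_filter -leqn0 leqNgt -has_count; apply/negP => hasw; move/negP: nohas; apply.
apply: sub_has hasw => m /eqP mw; rewrite /= mw eqxx andbT; apply/asboolP.
exact: nz.
Qed.

Lemma sum_poly_zero (S : Defs.Poly R N) psi x :
  wf_poly K T S -> poly_zero S -> smooth_on U psi -> U x ->
  \sum_(m <- S) m_Z0 m (gvec K T x) * act_rest K T (m_rest m) psi x = 0.
Proof.
move=> wS S0 spsi Ux; apply: (sum_fibers_eq0 (f := @beta R N)) => b.
exact: (Sbeta_zero_act oU UK sT).
Qed.

Lemma abel_mainpart_eq0 (S : Defs.Poly R N) x p : wf_poly K T S ->
  (forall psi, smooth_on U psi -> forall y, U y -> poly_act K T S psi y = 0) ->
  U x -> abel (mainpart K T S) (msyms x p) = 0.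
Proof.
move=> wS S0 Ux; rewrite /mainpart; case: asboolP => [_|nz].
  by rewrite /abel big_nil.
set d := degw K T S; pose psi := phase_pow x p d.
have spsi V : open V -> smooth_on V psi by exact: smooth_phase_pow.
pose a m := m_Z0 m (gvec K T x) * act_rest K T (m_rest m) psi x.
(* A positive power of the phase is left over, and it vanishes at [x]. *)
have low m : wf_mono K T m -> (weight K T m < d)%N -> a m = 0.
  move=> [_ wm] md; rewrite /a.
  have := @lead_act_rest x p (m_rest m) (d - weight K T m) psi Ux wm (spsi _ oU).
  rewrite [X in (X + _)%N]( _ : _ = weight K T m)// subnKC ?(ltnW md)//.
  move=> /(_ (lead_pow _ _ _ _)) /(lead_valS Ux) ->; first by rewrite mulr0.
  by rewrite subn_gt0.
(* All [d] powers are used up, leaving the product of main symbols. *)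
have top m : wf_mono K T m -> weight K T m == d ->
    a m = m_Z0 m (msyms x p) * \prod_(bz <- m_rest m) (bz.2 (msyms x p) * msyms x p 0 bz.1).
  move=> [wZ wm] /eqP md; rewrite /a wf_fun_msyms//; last exact: UK.
  congr (_ * _).
  have := @lead_act_rest x p (m_rest m) 0 psi Ux wm (spsi _ oU).
  rewrite [X in (X + _)%N]( _ : _ = weight K T m)// addn0 md.
  move=> /(_ (lead_pow _ _ _ _)) /(lead_val0 Ux) ->.
  elim: (m_rest m) wm => [|bz rs IHrs]; first by rewrite !big_nil.
  move=> [[_ wbz] wrs]; rewrite !big_cons IHrs// wf_fun_msyms//; last exact: UK.
  by rewrite mxE.
(* The list may still hold monomials of weight above [d]; they cancel within each weight, as
   [Cd K T w S] is formally zero there. *)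
have high : \sum_(m <- S | (d < weight K T m)%N) a m = 0.
  rewrite -big_filter; apply: (sum_fibers_eq0 (f := weight K T)) => w.
  rewrite big_filter_cond; have [dw|wd] := ltnP d w.
    rewrite -[RHS](@sum_poly_zero (Cd K T w S) psi x)//.
    - rewrite /Cd big_filter; apply: eq_bigl => m.
      by case: eqVneq => [->|]; rewrite ?dw ?andbF.
    - exact: wf_poly_filter.
    - exact: poly_zero_gt_degw.
    - exact: spsi.
  rewrite big_pred0// => m; case: eqVneq => [->|]; rewrite ?andbF// andbT.
  by rewrite ltnNge wd.
rewrite -[RHS](S0 psi (spsi _ oU) x Ux) /poly_act -/(a _).
rewrite [RHS](bigID (fun m => weight K T m == d)) /=.
rewrite [X in _ = _ + X](bigID (fun m => (d < weight K T m)%N)) /=.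
rewrite [X in _ = _ + (X + _)](_ : _ = 0); last first.
  rewrite -[RHS]high; apply: eq_bigl => m.
  by case: eqVneq => [->|]; rewrite ?ltnn.
rewrite add0r [X in _ = _ + X](_ : _ = 0) ?addr0; last first.
  rewrite (eq_sum_wf (G := fun=> 0) wS) => [|m wm /andP[md nmd]]; first by rewrite big1.
  by apply: low => //; rewrite ltn_neqAle md leqNgt.
by rewrite /abel /Cd big_filter (eq_sum_wf wS top).
Qed.

Lemma smooth_abel (S : Defs.Poly R N) : wf_poly K T S ->
  smooth_on [set: 'rV[R]_N] (abel S).
Proof.
have oT : open [set: 'rV[R]_N] by exact: openT.
rewrite /abel; elim: S => [|m S IHS].
  move=> _; rewrite (_ : (fun v => _) = cst 0); first exact: smooth_cst.
  by apply/funext => v; rewrite big_nil.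
move=> [[[sZ _] wm] wS].
under eq_fun do rewrite big_cons.
apply: (smoothD oT); last exact: IHS.
apply: (smoothM oT sZ); elim: (m_rest m) wm => [|bz rs IHrs].
  move=> _; rewrite (_ : (fun v => _) = cst 1); first exact: smooth_cst.
  by apply/funext => v; rewrite big_nil.
move=> [[_ [sb _]] wrs]; under eq_fun do rewrite big_cons.
apply: (smoothM oT); last exact: IHrs.
by apply: (smoothM oT sb); exact: smooth_coord.
Qed.

Lemma wf_poly_mainpart (S : Defs.Poly R N) :
  wf_poly K T S -> wf_poly K T (mainpart K T S).
Proof. by move=> wS; rewrite /mainpart; case: asboolP => // _; exact: wf_poly_filter. Qed.

End MainSymbol.

(** * Jacobians of main symbols *)

Section Jacobian.
Variables (R : realType) (n : nat) (K : set 'rV[R]_n).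
Hypothesis oK : open K.

Lemma classO_Hg (F : Op R n) g : classO K F -> classO K (Hg F g).
Proof. by move=> sF alpha /=; case: ifP => _; [exact: sF|exact: smooth_cst]. Qed.

Lemma smooth_msym (F : Op R n) p : classO K F -> smooth_on K (fun y => msym K F y p).
Proof.
move=> sF; rewrite /msym; case: asboolP => _; last exact: smooth_cst.
apply: (smooth_sum _ oK) => alpha _; apply: (smoothM oK); last exact: smooth_cst.
exact: classO_Hg.
Qed.

Lemma smooth_msym_momentum (F : Op R n) x :
  smooth_on [set: 'rV[R]_n] (fun q => msym K F x q).
Proof.
have oT : open [set: 'rV[R]_n] by exact: openT.
rewrite /msym; case: asboolP => _; last exact: smooth_cst.
apply: (smooth_sum _ oT) => alpha _; apply: (smoothM oT); first exact: smooth_cst.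
by apply: (smooth_prod _ oT) => i _; apply: (smoothX _ oT); exact: smooth_coord.
Qed.

(** Joint continuity in position and momentum keeps the determinant of the dependence condition
    nonzero near the base point. *)
Lemma continuous_msym (F : Op R n) x p : K x -> classO K F ->
  {for (x, p), continuous (fun z : 'rV[R]_n * 'rV[R]_n => msym K F z.1 z.2)}.
Proof.
move=> Kx sF; rewrite /msym; case: asboolP => _; last exact: cst_continuous.
apply: continuous_sum => alpha _; apply: continuousM.
  apply: (@continuous_comp _ _ _ fst (@op_coef R n (Hg F (ord K F)) alpha)); first exact: cvg_fst.
  exact: (smooth_continuous (@classO_Hg F (ord K F) sF alpha) Kx).
apply: continuous_prod => i _.
apply: (@continuous_comp _ _ _ (fun z : 'rV[R]_n * 'rV[R]_n => z.2 0 i)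
  (fun r : R => r ^+ alpha i)).
  apply: (@continuous_comp _ _ _ snd (fun q : 'rV[R]_n => q 0 i)); first exact: cvg_snd.
  exact: coord_continuous.
exact: exprn_continuous.
Qed.

Lemma jac_relation N (T : 'I_N -> Op R n) (U : set 'rV[R]_n) (Phi : 'rV[R]_N -> R)
    x p j : open U -> U `<=` K -> classO_tuple K T ->
  smooth_on [set: 'rV[R]_N] Phi ->
  (forall y q, U y -> Phi (msyms K T y q) = 0) -> U x ->
  \sum_k partial k Phi (msyms K T x p) * jac K T x p k j = 0.
Proof.
move=> oU UK sT sPhi Phi0 Ux; have oT : open [set: 'rV[R]_N] by exact: openT.
have msymsE k y q : msyms K T y q 0 k = msym K (T k) y q by rewrite mxE.
under eq_bigr do rewrite mxE mulrC.
case: (fintype.split j) => a.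
  have dg k : derivable (fun y => msyms K T y p 0 k) x (unitv R a).
    under eq_fun do rewrite msymsE.
    exact: smooth_derivable (smooth_msym p (sT k)) (UK _ Ux).
  have [_] := smooth_chain (x := x) (v := unitv R a) (g := fun y => msyms K T y p) oT I sPhi dg.
  under [X in _ = X -> _]eq_bigr do under eq_fun do rewrite msymsE.
  move=> <-; rewrite -/(partial a _ x).
  (* In position directions the relation is known only on [U], which suffices since [U] is open. In
     momentum directions it holds for all [q]. *)
  rewrite (partial_eq (g := cst 0) a oU _ Ux); first exact: derive_cst.
  by move=> y Uy; exact: Phi0.
have dg k : derivable (fun q => msyms K T x q 0 k) p (unitv R a).
  under eq_fun do rewrite msymsE.
  exact: smooth_derivable (smooth_msym_momentum (T k) x) I.
have [_] := smooth_chain (x := p) (v := unitv R a) (g := fun q => msyms K T x q) oT I sPhi dg.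
under [X in _ = X -> _]eq_bigr do under eq_fun do rewrite msymsE.
move=> <-; rewrite (_ : _ \o _ = cst 0); first exact: derive_cst.
by apply/funext => q; exact: Phi0.
Qed.

Lemma jac_catT s r (W : 'I_s -> Op R n) (Y : 'I_r -> Op R n) x p :
  jac K (catT W Y) x p = col_mx (jac K W x p) (jac K Y x p).
Proof.
apply/matrixP => i j; rewrite !mxE /catT.
by case: (fintype.split i) => a; rewrite mxE.
Qed.

Lemma continuous_det (T : topologicalType) s (A : T -> 'M[R]_s) (z : T) :
  (forall i j, {for z, continuous (fun y => A y i j)}) ->
  {for z, continuous (fun y => \det (A y))}.
Proof.
move=> cA; apply: continuous_sum => sigma _.
apply: continuousM; first exact: cst_continuous.
by apply: continuous_prod => i _.
Qed.

Lemma alg_dep_jac s r (W : 'I_s -> Op R n) (Y : 'I_r -> Op R n) xb pb :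
  K xb -> classO_tuple K W -> classO_tuple K Y -> alg_dep K W Y xb pb ->
  \forall z \near (xb, pb), K z.1 /\ (jac K W z.1 z.2 <= jac K Y z.1 z.2)%MS.
Proof.
move=> Kxb sW sY [S [wS [detS [U [oU [Uxb [UK S0]]]]]]].
have sT : classO_tuple K (catT W Y).
  by move=> k; rewrite /catT; case: (fintype.split k) => i; [exact: sW|exact: sY].
set T := catT W Y in wS detS S0 sT.
pose Phi i := abel (mainpart K T (S i)).
have sPhi i : smooth_on [set: 'rV[R]_(s + r)] (Phi i).
  exact: smooth_abel (wf_poly_mainpart (wS i)).
have Phi0 i y q : U y -> Phi i (msyms K T y q) = 0.
  by move=> Uy; apply: (abel_mainpart_eq0 oU UK sT) => // psi spsi z; exact: S0.
pose P (z : 'rV[R]_n * 'rV[R]_n) : 'M[R]_(s, s + r) :=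
  \matrix_(i, k) partial k (Phi i) (msyms K T z.1 z.2).
have cmsyms : {for (xb, pb), continuous
    (fun z : 'rV[R]_n * 'rV[R]_n => msyms K T z.1 z.2)}.
  apply: rV_continuous => k.
  rewrite (_ : (fun y => _) = (fun z => msym K (T k) z.1 z.2)).
    exact: continuous_msym.
  by apply/funext => z; rewrite mxE.
have cdet : {for (xb, pb), continuous (fun z => \det (lsubmx (P z)))}.
  apply: continuous_det => i j.
  rewrite (_ : (fun y => _) = partial (lshift r j) (Phi i) \o
    (fun z : 'rV[R]_n * 'rV[R]_n => msyms K T z.1 z.2)).
    apply: continuous_comp => //.
    exact: smooth_continuous (smooth_partial _ (sPhi i)) _.
  by apply/funext => z; rewrite !mxE.
have detP : \det (lsubmx (P (xb, pb))) != 0.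
  move: detS; congr (\det _ != 0).
  by apply/matrixP => i j; rewrite !mxE.
have nU : \forall z \near (xb, pb), U z.1.
  by apply: (@cvg_fst _ _ (nbhs xb) (nbhs pb)); exact: open_nbhs_nbhs.
have ndet : \forall z \near (xb, pb), \det (lsubmx (P z)) != 0.
  exact: (cdet _ (open_nbhs_nbhs (conj (@open_neq _ 0) detP))).
near=> z; have Uz : U z.1 by near: z.
split; first exact: UK.
have Az : lsubmx (P z) \in unitmx.
  by rewrite unitmxE unitfE; near: z.
have : P z *m jac K T z.1 z.2 = 0.
  apply/matrixP => i j; rewrite !mxE.
  rewrite -[RHS](@jac_relation _ T U (Phi i) z.1 z.2 j oU UK sT (sPhi i) (Phi0 i) Uz).
  by apply: eq_bigr => k _; rewrite mxE.
(* In blocks [P = (A B)], the relation reads [A J_W + B J_Y = 0]; with [A] invertible,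
   [J_W = A^-1 (-B) J_Y]. *)
rewrite -[P z]hsubmxK /T jac_catT mul_row_col => /eqP; rewrite addr_eq0 => /eqP PJ.
rewrite -[jac K W _ _](mulKmx Az) PJ -mulNmx mulmxA; exact: submxMl.
Unshelve. all: by end_near. Qed.

Lemma alg_contained_jac s r (W : 'I_s -> Op R n) (Y : 'I_r -> Op R n) xb pb :
  K xb -> classO_tuple K W -> classO_tuple K Y -> alg_contained K xb pb W Y ->
  \forall z \near (xb, pb), K z.1 /\ (jac K W z.1 z.2 <= jac K Y z.1 z.2)%MS.
Proof.
move=> Kxb + + WY; elim: WY => {s r W Y} [s W r Y WY|s W k Z r Y sZ WZ _ IH] sW sY.
  exact: alg_dep_jac.
have nWZ := alg_dep_jac Kxb sW sZ WZ.
have nZY := IH sZ sY.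
near=> z; have [Kz WZz] : K z.1 /\ (jac K W z.1 z.2 <= jac K Z z.1 z.2)%MS by near: z.
have [_ ZYz] : K z.1 /\ (jac K Z z.1 z.2 <= jac K Y z.1 z.2)%MS by near: z.
by split => //; exact: submx_trans WZz ZYz.
Unshelve. all: by end_near. Qed.

Lemma regularly_dependent_near s (W : 'I_s -> Op R n) xb pb :
  K xb -> classO_tuple K W -> regularly_dependent K W xb pb ->
  \forall z \near (xb, pb), K z.1 /\ ~ quasi_indep K W z.1 z.2.
Proof.
move=> Kxb sW [r [Y [rs [sY WY]]]].
apply: filterS (alg_contained_jac Kxb sW sY WY) => z [Kz /mxrankS WYz].
split=> //; rewrite /quasi_indep /row_free => /eqP Ws.
move: rs; rewrite ltnNge => /negP; apply; rewrite -Ws.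
exact: leq_trans WYz (rank_leq_row _).
Qed.

End Jacobian.

(** * Boxes are not null sets *)

Section BoxCover.
Variable R : realType.
Implicit Types (a b z : nat -> R) (A B : nat -> nat -> R).

(** Points are sequences of which the first [m] terms count, so that an induction on the dimension
    needs no change of type. *)
Definition nbox_vol m a b : R := \prod_(i < m) (b i - a i).

Definition nbox_indic m a b z : R := \prod_(i < m) \1_(`[a i, b i]%classic) (z i).

Lemma nbox_indic_ge0 m a b z : 0 <= nbox_indic m a b z.
Proof. by apply: prodr_ge0 => i _; rewrite indicE ler0n. Qed.

Lemma nbox_vol_ge0 m a b : (forall i, a i <= b i) -> 0 <= nbox_vol m a b.
Proof. by move=> ab; apply: prodr_ge0 => i _; rewrite subr_ge0. Qed.

(* Induction on the dimension: the hypothesis on a slice bounds the slice volume, and one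
   integrates in the last coordinate. *)
Lemma nbox_cover m (C : R) (c : nat -> R) a b A B :
  0 <= C -> (forall k, 0 <= c k) -> (forall i, a i <= b i) ->
  (forall k i, A k i <= B k i) ->
  (forall z, (forall i, (i < m)%N -> a i <= z i <= b i) ->
     (C%:E <= \sum_(0 <= k <oo) (c k * nbox_indic m (A k) (B k) z)%:E)%E) ->
  ((C * nbox_vol m a b)%:E <= \sum_(0 <= k <oo) (c k * nbox_vol m (A k) (B k))%:E)%E.
Proof.
move=> + + ab AB; elim: m C c => [|m IHm] C c C0 c0 H.
  rewrite /nbox_vol big_ord0 mulr1; apply: le_trans (H a _) _ => //.
  rewrite le_eqVlt; apply/orP; left; apply/eqP/eq_eseriesr => k _.
  by rewrite /nbox_indic !big_ord0.
pose D := `[a m, b m]%classic.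
have mD : measurable D by exact: measurable_itv.
pose I k := `[A k m, B k m]%classic.
have mI k : measurable (I k) by exact: measurable_itv.
have muI (x y : R) : x <= y -> lebesgue_measure (`[x, y]%classic : set R) = (y - x)%:E.
  rewrite lebesgue_measure_itv/= lte_fin le_eqVlt => /orP[/eqP->|->].
    by rewrite ltxx subrr.
  by rewrite EFinB.
pose v k := c k * nbox_vol m (A k) (B k).
have v0 k : 0 <= v k by rewrite mulr_ge0// nbox_vol_ge0.
(* With the last coordinate fixed at [x], its indicator is absorbed into the weights [c k]. This is
   why the statement allows arbitrary nonnegative weights. *)
have slice x : D x ->
    ((C * nbox_vol m a b)%:E <= \sum_(0 <= k <oo) (v k)%:E * (\1_(I k) x)%:E)%E.
  rewrite /D/= in_itv/= => Dx.
  have := IHm C (fun k => c k * \1_(I k) x) C0.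
  rewrite (eq_eseriesr (g := fun k => ((v k)%:E * (\1_(I k) x)%:E)%E)); last first.
    by move=> k _; rewrite -EFinM /v mulrAC.
  apply=> [k|z Dz]; first by rewrite mulr_ge0// indicE ler0n.
  have := H (fun i => if (i < m)%N then z i else x).
  rewrite (eq_eseriesr (g := fun k => (c k * \1_(I k) x * nbox_indic m (A k) (B k) z)%:E)).
    apply=> i im; case: ifPn => [im'|]; first exact: Dz.
    rewrite -leqNgt => mi; have -> // : i = m.
    by apply/eqP; rewrite eqn_leq mi -ltnS im.
  move=> k _; congr EFin; rewrite /nbox_indic big_ord_recr /= ltnn -mulrA; congr (_ * _).
  rewrite mulrC; congr (_ * _); apply: eq_bigr => i _.
  by rewrite ltn_ord.
have mterm k : measurable_fun D ((fun x : R => (v k)%:E * (\1_(I k) x)%:E)%E : R -> \bar R).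
  apply: measurable_funeM; apply/measurable_EFinP.
  exact: measurable_indic.
have term0 k x : (0 <= (v k)%:E * (\1_(I k) x)%:E)%E.
  by rewrite -EFinM lee_fin mulr_ge0// indicE ler0n.
have step1 : (\int[lebesgue_measure]_(x in D) (cst (C * nbox_vol m a b)%:E x) <=
  \int[lebesgue_measure]_(x in D) \sum_(0 <= k <oo) (v k)%:E * (\1_(I k) x)%:E)%E.
  apply: ge0_le_integral => //.
  - by move=> x _; rewrite lee_fin mulr_ge0// nbox_vol_ge0.
  - exact: (@ge0_emeasurable_sum _ _ _ D (fun k x => (v k)%:E * (\1_(I k) x)%:E)%E predT).
have muD : lebesgue_measure D = (b m - a m)%:E by exact: muI.
move: step1; rewrite integral_cst//= muD integral_nneseries// => step1.
rewrite [nbox_vol m.+1 a b]big_ord_recr /= mulrA EFinM; apply: le_trans step1 _.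
apply: lee_nneseries => [k _ _|k _].
  by apply: integral_ge0 => x _.
rewrite ge0_integralZl_EFin//; last first.
  apply/measurable_EFinP; apply: measurable_indic; first exact: mI.
rewrite integral_indic; [|exact: mD|exact: mI].
have -> : (c k * nbox_vol m.+1 (A k) (B k))%:E =
    ((v k)%:E * lebesgue_measure (I k))%E.
  by rewrite muI// -EFinM /v /nbox_vol big_ord_recr /= mulrA.
(* The integral produced the measure of the part of [I k] inside [D], at most that of [I k]. *)
rewrite lee_wpmul2l ?lee_fin//; apply: le_measure; rewrite ?inE//; last first.
- exact: mI.
- by apply: measurableI; [exact: mI|exact: mD].
Qed.

Lemma box_not_null m (a b : 'rV[R]_m) (S : set 'rV[R]_m) :
  (forall i, a 0 i < b 0 i) -> (forall z : 'rV[R]_m, in_box a b z -> S z) -> ~ Defs.null_set S.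
Proof.
move=> ab abS nullS.
have vol0 : 0 < box_vol a b by apply: prodr_gt0 => i _; rewrite subr_gt0.
(* Half the volume of the box is a total too small for a cover. *)
have [|A [B [AB [cov sumAB]]]] := nullS (box_vol a b / 2); first by rewrite divr_gt0.
pose ext (x : 'rV[R]_m) (i : nat) : R := if insub i is Some j then x 0 j else 0.
have extE x (i : 'I_m) : ext x i = x 0 i by rewrite /ext valK.
have ext_le (x y : 'rV[R]_m) : (forall i, x 0 i <= y 0 i) -> forall i, ext x i <= ext y i.
  by move=> xy i; rewrite /ext; case: insub.
have volE (x y : 'rV[R]_m) : nbox_vol m (ext x) (ext y) = box_vol x y.
  by apply: eq_bigr => i _; rewrite !extE.
have : ((1 * nbox_vol m (ext a) (ext b))%:E <=
    \sum_(0 <= k <oo) (1 * nbox_vol m (ext (A k)) (ext (B k)))%:E)%E.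
  apply: nbox_cover => //; first by apply: ext_le => i; exact: ltW.
    by move=> k; exact: ext_le.
  move=> z abz; pose zr : 'rV[R]_m := \row_i z i.
  have [|k zk] := cov zr.
    by apply: abS => i; rewrite mxE -!extE; exact: abz.
  (* The partial sum up to the box [k] containing the point is already at least 1. *)
  apply: le_trans (nneseries_lim_ge k.+1 _); last first.
    by move=> j _ _; rewrite mul1r lee_fin nbox_indic_ge0.
  rewrite big_nat_recr//= mul1r.
  have -> : nbox_indic m (ext (A k)) (ext (B k)) z = 1.
    apply: big1 => i _; rewrite indicE mem_set//= in_itv/= !extE.
    by have := zk i; rewrite mxE.
  by rewrite leeDr// sume_ge0// => j _; rewrite mul1r lee_fin nbox_indic_ge0.
apply/negP; rewrite -ltNge mul1r volE.
apply: (@le_lt_trans _ _ (box_vol a b / 2)%:E); last first.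
  by rewrite lte_fin ltr_pdivrMr// ltr_pMr// ltr1n.
(* Every partial sum of the volumes is at most half the volume, hence so is the limit. *)
apply: lime_le.
  apply: is_cvg_nneseries => k _ _; rewrite mul1r lee_fin nbox_vol_ge0//.
  by apply: ext_le.
apply: nearW => N; rewrite sumEFin lee_fin big_mkord.
by under eq_bigr do rewrite mul1r volE.
Qed.

End BoxCover.

Theorem theorem3p35 (R : realType) (n s : nat) (K : set 'rV[R]_n)
  (W : 'I_s -> Op R n) (xb pb : 'rV[R]_n) :
  open K -> classO_tuple K W -> K xb ->
  regularly_dependent K W xb pb ->
  (exists O : set ('rV[R]_n * 'rV[R]_n),
      nbhs (xb, pb) O /\ O `<=` K `*` [set: 'rV[R]_n] /\
      forall x p, O (x, p) -> ~ quasi_indep K W x p) /\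
  ~ globally_quasi_indep K W.
Proof.
move=> oK sW Kxb regW; have nW := regularly_dependent_near oK Kxb sW regW.
split.
  exists [set z | K z.1 /\ ~ quasi_indep K W z.1 z.2]; split=> //.
  by split=> [[x p] [Kx _]|x p []].
move: nW => /nbhs_ballP[e /= e0 eW].
pose c : 'rV[R]_(n + n) := row_mx xb pb.
(* The half-side [e / 2] puts the closed box inside the open ball of radius [e], where
   quasi-independence fails. *)
pose a : 'rV[R]_(n + n) := \row_i (c 0 i - e / 2).
pose b : 'rV[R]_(n + n) := \row_i (c 0 i + e / 2).
apply: (@box_not_null R (n + n) a b) => [i|z abz].
  by rewrite !mxE ltrD2l (lt_trans (y := 0))// ?oppr_lt0 divr_gt0.
have ze i : `|c 0 i - z 0 i| < e.
  have := abz i; rewrite !mxE => zi; rewrite ltr_norml.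
  by lra.
apply: (eW (lsubmx z, rsubmx z)); split=> /=; split=> // i j; rewrite ord1 mxE.
  by have := ze (lshift n j); rewrite row_mxEl.
by have := ze (rshift n j); rewrite row_mxEr.
Qed.
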